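(* The fibration $\mathsf{R}\text{-}\mathbf{Alg}\to\mathbf{Gpd}$ is elementary.
   Context: **The monad $\mathsf{R}$ on groupoids.** $\mathbf{Gpd}$ is the category of small groupoids and functors, $\mathbf{Gpd}^{\mathbf 2}$ its arrow category. For a functor $F:\mathbb{A}\to\mathbb{B}$ between groupoids let $\mathsf{M}F$ be the groupoid whose objects are pairs $(A,x:B\xrightarrow{\sim}FA)$ with $A$ an object of $\mathbb{A}$ and $x$ an (iso)morphism of $\mathbb{B}$, and whose arrows $(A,x:B\to FA)\to(A',x':B'\to FA')$ are pairs $(b:B\to B',a:A\to A')$ with $x'b=F(a)x$. For a commutative square $(H_0,H_1):F\to F'$ (so $F'H_1=H_0F$), $\mathsf{M}(H_0,H_1)(A,x)=(H_1A,H_0x)$. Let $\mathsf{R}F:\mathsf{M}F\to\mathbb{B}$, $(A,x:B\to FA)\mapsto B$, and $\mathsf{L}F:\mathbb{A}\to\mathsf{M}F$, $A\mapsto(A,\mathrm{id}_{FA})$. $\mathsf{R}$ is a monad on $\mathbf{Gpd}^{\mathbf 2}$ with unit $(\mathrm{Id}_{\mathbb{B}},\mathsf{L}F):F\to\mathsf{R}F$ and multiplication $(\mathrm{Id}_{\mathbb{B}},\mu_F):\mathsf{R}\mathsf{R}F\to\mathsf{R}F$, $\mu_F((A,x:B\to FA),x':B'\to B)=(A,xx')$. $\mathsf{R}\text{-}\mathbf{Alg}$ is the category of algebras for this monad: objects are pairs $(F:\mathbb{A}\to\mathbb{B},\,S:\mathsf{M}F\to\mathbb{A})$ of functors between groupoids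 with $FS=\mathsf{R}F$, $S\circ\mathsf{L}F=\mathrm{Id}_{\mathbb{A}}$ and $S\circ\mathsf{M}(\mathrm{Id}_{\mathbb{B}},S)=S\circ\mu_F$ (equivalently, split cloven isofibrations of groupoids); arrows $(F,S)\to(F',S')$ are commutative squares $(H_0,H_1):F\to F'$ with $H_1S=S'\,\mathsf{M}(H_0,H_1)$. The functor $\mathsf{R}\text{-}\mathbf{Alg}\to\mathbf{Gpd}$ sends $(F:\mathbb{A}\to\mathbb{B},S)$ to $\mathbb{B}$ and $(H_0,H_1)$ to $H_0$; it is a fibration with finite products. **Elementary fibration.** A fibration with finite products $p:\mathcal{E}\to\mathcal{B}$ ($\mathcal{B}$ and all fibres have finite products, denoted $\wedge$ in fibres, preserved by reindexing $f^*$) is *elementary* if for all $Y,X$ in $\mathcal{B}$ reindexing along the parametrised diagonal $\mathrm{pr}_{1,2,2}=\langle\mathrm{pr}_1,\mathrm{pr}_2,\mathrm{pr}_2\rangle:Y\times X\to Y\times X\times X$ has a left adjoint $\exists_{Y,X}:\mathcal{E}_{Y\times X}\to\mathcal{E}_{Y\times X\times X}$ and these satisfy: (Frobenius Reciprocity) for every $A$ over $Y\times X$ and $B$ over $Y\times X\times X$ the canonical arrow $\exists_{Y,X}(\mathrm{pr}_{1,2,2}^*B\wedge A)\to B\wedge\exists_{Y,X}A$ is iso; (Beck-Chevalley Condition) for every $f:Y\to Z$ and every $A$ over $Z\times X$ the canonical arrow $\exists_{Y,X}(f\times X)^*A\to(f\times X\times X)^*\exists_{Z,X}A$ is iso. 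*)

(* Defs.v *)
From Stdlib Require Import ssreflect.
From Stdlib Require Import FunctionalExtensionality ProofIrrelevance.

Set Implicit Arguments.
Unset Strict Implicit.
Unset Printing Implicit Defensive.

Declare Scope cat_scope.
Delimit Scope cat_scope with cat.
Declare Scope gpd_scope.
Delimit Scope gpd_scope with gpd.

(** * Categories *)

Record category := Category {
  ob :> Type;
  hom : ob -> ob -> Type;
  idm : forall x, hom x x;
  comp : forall x y z, hom y z -> hom x y -> hom x z;
  comp1m : forall x y (f : hom x y), comp (idm y) f = f;
  compm1 : forall x y (f : hom x y), comp f (idm x) = f;
  compA : forall x y z w (h : hom z w) (g : hom y z) (f : hom x y),
    comp h (comp g f) = comp (comp h g) f }.

Arguments idm {_} _.
Arguments comp {_ _ _ _} _ _.
Arguments comp1m {_ _ _} _.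
Arguments compm1 {_ _ _} _.
Arguments compA {_ _ _ _ _} _ _ _.

Notation "g ∘ f" := (comp g f) (at level 40, left associativity) : cat_scope.
Local Open Scope cat_scope.

Record functor (C D : category) := Functor {
  fob :> C -> D;
  fmap : forall x y, hom x y -> hom (fob x) (fob y);
  fmap1 : forall x, fmap (idm x) = idm (fob x);
  fmapM : forall x y z (g : hom y z) (f : hom x y),
    fmap (g ∘ f) = fmap g ∘ fmap f }.

Arguments fmap {_ _} _ {_ _} _.

Definition is_iso (C : category) (x y : C) (f : hom x y) : Prop :=
  exists g : hom y x, g ∘ f = idm x /\ f ∘ g = idm y.

(* The identity arrow, seen as an arrow between two equal objects. *)
Definition idto (C : category) (x y : C) (e : x = y) : hom x y :=
  match e in _ = y return hom x y with eq_refl => idm x end.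

Record left_adjoint (C D : category) (G : functor C D) := LeftAdjoint {
  ladj :> functor D C;
  unit : forall d : D, hom d (G (ladj d));
  counit : forall c : C, hom (ladj (G c)) c;
  unit_nat : forall d d' (f : hom d d'),
    unit d' ∘ f = fmap G (fmap ladj f) ∘ unit d;
  counit_nat : forall c c' (f : hom c c'),
    f ∘ counit c = counit c' ∘ fmap ladj (fmap G f);
  triangle_l : forall d, counit (ladj d) ∘ fmap ladj (unit d) = idm (ladj d);
  triangle_r : forall c, fmap G (counit c) ∘ unit (G c) = idm (G c) }.

Arguments unit {_ _ _} _ _.
Arguments counit {_ _ _} _ _.

Definition transpose (C D : category) (G : functor C D) (L : left_adjoint G)
    (d : D) (c : C) (f : hom d (G c)) : hom (L d) c :=
  counit L c ∘ fmap L f.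

(** * Finite products *)

Definition is_terminal (C : category) (t : C) : Prop :=
  forall x : C, exists! h : hom x t, True.

Definition is_product (C : category) (a b c : C)
    (p : hom c a) (q : hom c b) : Prop :=
  forall (x : C) (f : hom x a) (g : hom x b),
    exists! h : hom x c, p ∘ h = f /\ q ∘ h = g.

Record finite_products (C : category) := FiniteProducts {
  top : C;
  to_top : forall x : C, hom x top;
  to_top_uniq : forall (x : C) (f : hom x top), f = to_top x;
  cprod : C -> C -> C;
  pr1 : forall a b, hom (cprod a b) a;
  pr2 : forall a b, hom (cprod a b) b;
  cpair : forall x a b, hom x a -> hom x b -> hom x (cprod a b);
  pr1_cpair : forall x a b (f : hom x a) (g : hom x b),
    pr1 a b ∘ cpair f g = f;
  pr2_cpair : forall x a b (f : hom x a) (g : hom x b),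
    pr2 a b ∘ cpair f g = g;
  cpair_uniq : forall x a b (h : hom x (cprod a b)),
    h = cpair (pr1 a b ∘ h) (pr2 a b ∘ h) }.

Arguments top {_} _.
Arguments cprod {_} _ _ _.
Arguments pr1 {_} _ _ _.
Arguments pr2 {_} _ _ _.
Arguments cpair {_} _ {_ _ _} _ _.
Arguments cpair_uniq {_} _ {_ _ _} _.

Definition preserves_products (C D : category) (P : finite_products C)
    (F : functor C D) : Prop :=
  is_terminal (F (top P)) /\
  forall a b, is_product (fmap F (pr1 P a b)) (fmap F (pr2 P a b)).

Section Products.
Variables (C : category) (P : finite_products C).

Definition prod_map (a a' b b' : C) (f : hom a a') (g : hom b b') :
    hom (cprod P a b) (cprod P a' b') :=
  cpair P (f ∘ pr1 P a b) (g ∘ pr2 P a b).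

(* The ternary product Y x X x X is bracketed as (Y x X) x X. *)
Definition pr122 (Y X : C) : hom (cprod P Y X) (cprod P (cprod P Y X) X) :=
  cpair P (cpair P (pr1 P Y X) (pr2 P Y X)) (pr2 P Y X).

Lemma cpair_comp (w x a b : C) (f : hom x a) (g : hom x b) (h : hom w x) :
  cpair P f g ∘ h = cpair P (f ∘ h) (g ∘ h).
Proof. by rewrite [LHS](cpair_uniq P) !compA pr1_cpair pr2_cpair. Qed.

Lemma pr122_nat (Y Z X : C) (f : hom Y Z) :
  pr122 Z X ∘ prod_map f (idm X)
  = prod_map (prod_map f (idm X)) (idm X) ∘ pr122 Y X.
Proof.
rewrite /pr122 /prod_map.
do 4! rewrite ?cpair_comp ?comp1m -?compA ?pr1_cpair ?pr2_cpair.
by [].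
Qed.

End Products.

(** * Fibrations *)

Section Fibrations.
Variables (E B : category) (p : functor E B).

Record fibre_ob (X : B) := FibreOb {
  fibre_val :> E;
  fibre_over : p fibre_val = X }.

(* The image of [g] is [f], up to the equalities [p a = X] and [p b = Y]. *)
Definition is_over (X Y : B) (f : hom X Y) (a : fibre_ob X) (b : fibre_ob Y)
    (g : hom (fibre_val a) (fibre_val b)) : Prop :=
  idto (fibre_over b) ∘ fmap p g = f ∘ idto (fibre_over a).

Record hom_over (X Y : B) (f : hom X Y) (a : fibre_ob X) (b : fibre_ob Y) :=
  HomOver {
    over_val : hom (fibre_val a) (fibre_val b);
    over_valP : is_over f over_val }.

Lemma hom_over_eq (X Y : B) (f : hom X Y) (a : fibre_ob X) (b : fibre_ob Y)
    (g g' : hom_over f a b) : over_val g = over_val g' -> g = g'.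
Proof.
case: g g' => [g gP] [g' g'P] /= e; subst g'.
by rewrite (proof_irrelevance _ gP g'P).
Qed.

Lemma is_over_id (X : B) (a : fibre_ob X) :
  is_over (idm X) (idm (fibre_val a)).
Proof. by rewrite /is_over fmap1 comp1m compm1. Qed.

Lemma is_over_comp (X Y Z : B) (f : hom X Y) (f' : hom Y Z) (a : fibre_ob X)
    (b : fibre_ob Y) (c : fibre_ob Z) (g' : hom_over f' b c)
    (g : hom_over f a b) :
  is_over (f' ∘ f) (over_val g' ∘ over_val g).
Proof.
rewrite /is_over fmapM compA (over_valP g') -compA (over_valP g).
by rewrite compA.
Qed.

Definition over_comp (X Y Z : B) (f : hom X Y) (f' : hom Y Z)
    (a : fibre_ob X) (b : fibre_ob Y) (c : fibre_ob Z) (g' : hom_over f' b c)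
    (g : hom_over f a b) : hom_over (f' ∘ f) a c :=
  HomOver (is_over_comp g' g).

Definition over_cast (X Y : B) (f f' : hom X Y) (e : f = f') (a : fibre_ob X)
    (b : fibre_ob Y) (g : hom_over f a b) : hom_over f' a b :=
  HomOver (eq_ind f (fun f => is_over f (over_val g)) (over_valP g) f' e).

Section Fibre.
Variable X : B.

Definition fibre_id (a : fibre_ob X) : hom_over (idm X) a a := HomOver (is_over_id a).

Definition fibre_comp (a b c : fibre_ob X) (g : hom_over (idm X) b c)
    (f : hom_over (idm X) a b) : hom_over (idm X) a c :=
  over_cast (comp1m (idm X)) (over_comp g f).

Lemma fibre_comp1m a b (f : hom_over (idm X) a b) : fibre_comp (fibre_id b) f = f.
Proof. by apply: hom_over_eq; rewrite /= comp1m. Qed.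

Lemma fibre_compm1 a b (f : hom_over (idm X) a b) : fibre_comp f (fibre_id a) = f.
Proof. by apply: hom_over_eq; rewrite /= compm1. Qed.

Lemma fibre_compA a b c d (h : hom_over (idm X) c d)
    (g : hom_over (idm X) b c) (f : hom_over (idm X) a b) :
  fibre_comp h (fibre_comp g f) = fibre_comp (fibre_comp h g) f.
Proof. by apply: hom_over_eq; rewrite /= compA. Qed.

Definition fibre : category := Category fibre_comp1m fibre_compm1 fibre_compA.

End Fibre.

Record cartesian_lift (X Y : B) (f : hom X Y) (b : fibre_ob Y) :=
  CartesianLift {
    lift_ob : fibre_ob X;
    lift : hom_over f lift_ob b;
    factor : forall (W : B) (u : hom W X) (c : fibre_ob W),
      hom_over (f ∘ u) c b -> hom_over u c lift_ob;
    factorK : forall (W : B) (u : hom W X) (c : fibre_ob W)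
      (k : hom_over (f ∘ u) c b), over_comp lift (factor k) = k;
    factor_uniq : forall (W : B) (u : hom W X) (c : fibre_ob W)
      (h : hom_over u c lift_ob), h = factor (over_comp lift h) }.

Definition cleavage : Type :=
  forall (X Y : B) (f : hom X Y) (b : fibre_ob Y), cartesian_lift f b.

Section Reindexing.
Variables (K : cleavage) (X Y : B) (f : hom X Y).

Definition reindex_ob (b : fibre Y) : fibre X := lift_ob (K f b).

Definition reindex_map (b b' : fibre Y) (g : hom b b') : hom (reindex_ob b) (reindex_ob b') :=
  factor (K f b') (over_cast (eq_trans (comp1m f) (eq_sym (compm1 f)))
                    (over_comp g (lift (K f b)))).

Lemma reindex_mapE (b b' : fibre Y) (g : hom b b') (h : hom (reindex_ob b) (reindex_ob b')) :
  over_val (lift (K f b')) ∘ over_val h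
    = over_val g ∘ over_val (lift (K f b)) ->
  reindex_map g = h.
Proof.
move=> e; rewrite [RHS](@factor_uniq _ _ _ _ (K f b')).
by congr (factor _ _); apply: hom_over_eq; rewrite /= e.
Qed.

Lemma reindex_mapP (b b' : fibre Y) (g : hom b b') :
  over_val (lift (K f b')) ∘ over_val (reindex_map g)
    = over_val g ∘ over_val (lift (K f b)).
Proof. exact: (f_equal (fun k => over_val k) (factorK (K f b') _)). Qed.

Lemma reindex1 b : reindex_map (idm b) = idm (reindex_ob b).
Proof. by apply: reindex_mapE; rewrite /= comp1m compm1. Qed.

Lemma reindexM b c d (h : hom c d) (g : hom b c) :
  reindex_map (h ∘ g) = reindex_map h ∘ reindex_map g.
Proof. by apply: reindex_mapE; rewrite /= compA reindex_mapP -!compA reindex_mapP. Qed.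

Definition reindex : functor (fibre Y) (fibre X) := Functor reindex1 reindexM.

End Reindexing.

Record finite_products_fibration := FiniteProductsFibration {
  cleav : cleavage;
  base_prod : finite_products B;
  fibre_prod : forall X : B, finite_products (fibre X);
  reindex_prod : forall (X Y : B) (f : hom X Y),
    preserves_products (fibre_prod Y) (reindex cleav f) }.

Section Elementary.
Variable P : finite_products_fibration.

Local Notation bprod := (cprod (base_prod P)).
Local Notation diag := (pr122 (base_prod P)).
Local Notation re := (reindex (cleav P)).

Definition frobenius_arrow (Y X : B) (L : left_adjoint (re (diag Y X)))
    (A : fibre (bprod Y X)) (A' : fibre (bprod (bprod Y X) X)) :
    hom (L (cprod (fibre_prod P _) (re (diag Y X) A') A))
        (cprod (fibre_prod P _) A' (L A)) :=
  let Q := fibre_prod P (bprod Y X) in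
  cpair (fibre_prod P _)
    (transpose L (pr1 Q (re (diag Y X) A') A))
    (fmap L (pr2 Q (re (diag Y X) A') A)).

(* The composite of the unit [A -> diag^* (L A)] with the cartesian arrows
   [(f x X)^* A -> A] and [diag^* (L A) -> L A] lies over
   [diag o (f x X) = (f x X x X) o diag]; it is factored through the
   cartesian arrow over [f x X x X], then through the one over [diag],
   and finally transposed. *)
Definition beck_chevalley_arrow (Y Z X : B) (f : hom Y Z)
    (LY : left_adjoint (re (diag Y X))) (LZ : left_adjoint (re (diag Z X)))
    (A : fibre (bprod Z X)) :
    let fX := prod_map (base_prod P) f (idm X) in
    let fXX := prod_map (base_prod P) fX (idm X) in
    hom (LY (re fX A)) (re fXX (LZ A)) :=
  let fX := prod_map (base_prod P) f (idm X) in
  let fXX := prod_map (base_prod P) fX (idm X) in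
  let A' := lift_ob (cleav P fX A) in
  let k : hom_over (fXX ∘ diag Y X) A' (LZ A) :=
    over_cast (eq_trans (f_equal (fun g => g ∘ fX) (compm1 (diag Z X)))
                        (pr122_nat (base_prod P) X f))
      (over_comp (over_comp (lift (cleav P (diag Z X) (LZ A))) (unit LZ A))
                 (lift (cleav P fX A))) in
  let h : hom_over (diag Y X) A' (re fXX (LZ A)) :=
    factor (cleav P fXX (LZ A)) k in
  let g : hom_over (idm (bprod Y X)) A' (re (diag Y X) (re fXX (LZ A))) :=
    factor (cleav P (diag Y X) (re fXX (LZ A)))
      (over_cast (eq_sym (compm1 (diag Y X))) h) in
  transpose LY g.

Definition elementary : Prop :=
  exists L : forall Y X : B, left_adjoint (re (diag Y X)),
    (forall (Y X : B) (A : fibre (bprod Y X))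
        (A' : fibre (bprod (bprod Y X) X)),
      is_iso (frobenius_arrow (L Y X) A A')) /\
    (forall (Y Z X : B) (f : hom Y Z) (A : fibre (bprod Z X)),
      is_iso (beck_chevalley_arrow f (L Y X) (L Z X) A)).

End Elementary.

Definition elementary_fibration : Prop :=
  exists P : finite_products_fibration, elementary P.

End Fibrations.

(** * Small groupoids *)

Record groupoid := Groupoid {
  gob :> Type;
  ghom : gob -> gob -> Type;
  gid : forall x, ghom x x;
  gcomp : forall x y z, ghom y z -> ghom x y -> ghom x z;
  ginv : forall x y, ghom x y -> ghom y x;
  gcomp1m : forall x y (f : ghom x y), gcomp (gid y) f = f;
  gcompm1 : forall x y (f : ghom x y), gcomp f (gid x) = f;
  gcompA : forall x y z w (h : ghom z w) (g : ghom y z) (f : ghom x y),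
    gcomp h (gcomp g f) = gcomp (gcomp h g) f;
  gcompVm : forall x y (f : ghom x y), gcomp (ginv f) f = gid x;
  gcompmV : forall x y (f : ghom x y), gcomp f (ginv f) = gid y }.

Arguments gid {_} _.
Arguments gcomp {_ _ _ _} _ _.
Arguments ginv {_ _ _} _.
Arguments gcomp1m {_ _ _} _.
Arguments gcompm1 {_ _ _} _.
Arguments gcompA {_ _ _ _ _} _ _ _.
Arguments gcompVm {_ _ _} _.
Arguments gcompmV {_ _ _} _.

Notation "g ∘ f" := (gcomp g f) (at level 40, left associativity) : gpd_scope.
Local Close Scope cat_scope.
Local Open Scope gpd_scope.

Record gfunctor (A B : groupoid) := GFunctor {
  gfob :> A -> B;
  gmap : forall x y, ghom x y -> ghom (gfob x) (gfob y);
  gmap1 : forall x, gmap (gid x) = gid (gfob x);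
  gmapM : forall x y z (g : ghom y z) (f : ghom x y),
    gmap (g ∘ f) = gmap g ∘ gmap f }.

Arguments gmap {_ _} _ {_ _} _.

Definition gidto (A : groupoid) (x y : A) (e : x = y) : ghom x y :=
  match e in _ = y return ghom x y with eq_refl => gid x end.

Lemma gidto_id (A : groupoid) (x : A) (e : x = x) : gidto e = gid x.
Proof. by rewrite (proof_irrelevance _ e eq_refl). Qed.

Lemma gmap_gidto (A B : groupoid) (F : gfunctor A B) (x y : A) (e : x = y) :
  gmap F (gidto e) = gidto (f_equal F e).
Proof. by case: y / e; rewrite /= gmap1. Qed.

Lemma gidto_comp (A : groupoid) (x y z : A) (e : x = y) (e' : y = z) :
  gidto e' ∘ gidto e = gidto (eq_trans e e').
Proof. by case: z / e'; rewrite /= gcomp1m. Qed.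

Lemma gfunctor_ext (A B : groupoid) (F G : gfunctor A B)
    (e : forall x, F x = G x) :
  (forall x y (f : ghom x y), gidto (e y) ∘ gmap F f = gmap G f ∘ gidto (e x)) ->
  F = G.
Proof.
case: F G e => [fo fm f1 fM] [go gm g1 gM] /= e em.
have eo : fo = go by apply: functional_extensionality.
subst go.
have efm : fm = gm.
  apply: functional_extensionality_dep => x.
  apply: functional_extensionality_dep => y.
  apply: functional_extensionality_dep => f.
  by move: (em _ _ f); rewrite !gidto_id gcomp1m gcompm1.
subst gm.
by rewrite (proof_irrelevance _ f1 g1) (proof_irrelevance _ fM gM).
Qed.

Definition gfid (A : groupoid) : gfunctor A A :=
  {| gfob := fun x => x; gmap := fun _ _ f => f;
     gmap1 := fun _ => eq_refl; gmapM := fun _ _ _ _ _ => eq_refl |}.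

Section GfComp.
Variables (A B C : groupoid) (G : gfunctor B C) (F : gfunctor A B).

Lemma gfcomp1 x : gmap G (gmap F (gid x)) = gid (G (F x)).
Proof. by rewrite !gmap1. Qed.

Lemma gfcompM x y z (g : ghom y z) (f : ghom x y) :
  gmap G (gmap F (g ∘ f)) = gmap G (gmap F g) ∘ gmap G (gmap F f).
Proof. by rewrite !gmapM. Qed.

Definition gfcomp : gfunctor A C :=
  {| gfob := fun x => G (F x); gmap := fun _ _ f => gmap G (gmap F f);
     gmap1 := gfcomp1; gmapM := gfcompM |}.

End GfComp.

Notation "G ⊙ F" := (gfcomp G F) (at level 40, left associativity) : gpd_scope.

Lemma gfcomp1m (A B : groupoid) (F : gfunctor A B) : gfid B ⊙ F = F.
Proof.
apply: (@gfunctor_ext _ _ (gfid B ⊙ F) (F) (fun _ => eq_refl)) => x y f.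
by rewrite /= gcomp1m gcompm1.
Qed.

Lemma gfcompm1 (A B : groupoid) (F : gfunctor A B) : F ⊙ gfid A = F.
Proof.
apply: (@gfunctor_ext _ _ (F ⊙ gfid A) (F) (fun _ => eq_refl)) => x y f.
by rewrite /= gcomp1m gcompm1.
Qed.

Lemma gfcompA (A B C D : groupoid) (H : gfunctor C D) (G : gfunctor B C)
    (F : gfunctor A B) : H ⊙ (G ⊙ F) = H ⊙ G ⊙ F.
Proof.
apply: (@gfunctor_ext _ _ (H ⊙ (G ⊙ F)) (H ⊙ G ⊙ F) (fun _ => eq_refl)) => x y f.
by rewrite /= gcomp1m gcompm1.
Qed.

Definition Gpd : category :=
  {| ob := groupoid; hom := gfunctor; idm := gfid; comp := gfcomp;
     comp1m := gfcomp1m; compm1 := gfcompm1; compA := gfcompA |}.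

Definition fob_eq (A B : groupoid) (F G : gfunctor A B) (e : F = G) (x : A) :
  F x = G x := f_equal (fun H : gfunctor A B => H x) e.

Lemma fob_eq_nat (A B : groupoid) (F G : gfunctor A B) (e : F = G) (x y : A)
    (f : ghom x y) :
  gidto (fob_eq e y) ∘ gmap F f = gmap G f ∘ gidto (fob_eq e x).
Proof. by case: G / e; rewrite /= gcomp1m gcompm1. Qed.

(** * The monad R *)

Section MFunctor.
Variables (A B : groupoid) (F : gfunctor A B).

Record M_ob := MOb {
  M_top : A;
  M_bot : B;
  M_arr : ghom M_bot (F M_top) }.

Record M_hom (u v : M_ob) := MHom {
  M_hbot : ghom (M_bot u) (M_bot v);
  M_htop : ghom (M_top u) (M_top v);
  M_hsq : M_arr v ∘ M_hbot = gmap F M_htop ∘ M_arr u }.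

Lemma M_hom_eq (u v : M_ob) (f g : M_hom u v) :
  M_hbot f = M_hbot g -> M_htop f = M_htop g -> f = g.
Proof.
case: f g => [b a s] [b' a' s'] /= eb ea; subst b' a'.
by rewrite (proof_irrelevance _ s s').
Qed.

Lemma M_id_sq (u : M_ob) :
  M_arr u ∘ gid (M_bot u) = gmap F (gid (M_top u)) ∘ M_arr u.
Proof. by rewrite gmap1 gcomp1m gcompm1. Qed.

Definition M_id (u : M_ob) : M_hom u u := MHom (M_id_sq u).

Lemma M_comp_sq (u v w : M_ob) (g : M_hom v w) (f : M_hom u v) :
  M_arr w ∘ (M_hbot g ∘ M_hbot f)
  = gmap F (M_htop g ∘ M_htop f) ∘ M_arr u.
Proof. by rewrite gcompA M_hsq -gcompA M_hsq gmapM gcompA. Qed.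

Definition M_comp (u v w : M_ob) (g : M_hom v w) (f : M_hom u v) : M_hom u w :=
  MHom (M_comp_sq g f).

Lemma M_inv_sq (u v : M_ob) (f : M_hom u v) :
  M_arr u ∘ ginv (M_hbot f) = gmap F (ginv (M_htop f)) ∘ M_arr v.
Proof.
rewrite -[LHS]gcomp1m -(gmap1 F) -(gcompVm (M_htop f)) gmapM -gcompA.
rewrite [X in _ ∘ X = _]gcompA -M_hsq -[X in _ ∘ X = _]gcompA gcompmV.
by rewrite gcompm1.
Qed.

Definition M_inv (u v : M_ob) (f : M_hom u v) : M_hom v u := MHom (M_inv_sq f).

Lemma M_comp1m u v (f : M_hom u v) : M_comp (M_id v) f = f.
Proof. by apply: M_hom_eq; rewrite /= gcomp1m. Qed.

Lemma M_compm1 u v (f : M_hom u v) : M_comp f (M_id u) = f.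
Proof. by apply: M_hom_eq; rewrite /= gcompm1. Qed.

Lemma M_compA u v w z (h : M_hom w z) (g : M_hom v w) (f : M_hom u v) :
  M_comp h (M_comp g f) = M_comp (M_comp h g) f.
Proof. by apply: M_hom_eq; rewrite /= gcompA. Qed.

Lemma M_compVm u v (f : M_hom u v) : M_comp (M_inv f) f = M_id u.
Proof. by apply: M_hom_eq; rewrite /= gcompVm. Qed.

Lemma M_compmV u v (f : M_hom u v) : M_comp f (M_inv f) = M_id v.
Proof. by apply: M_hom_eq; rewrite /= gcompmV. Qed.

Definition M : groupoid :=
  Groupoid M_comp1m M_compm1 M_compA M_compVm M_compmV.

Definition R : gfunctor M B :=
  {| gfob := M_bot : M -> B; gmap := M_hbot : forall u v : M, ghom u v -> _;
     gmap1 := fun _ => eq_refl; gmapM := fun _ _ _ _ _ => eq_refl |}.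

Lemma L_sq (x y : A) (a : ghom x y) :
  gid (F y) ∘ gmap F a = gmap F a ∘ gid (F x).
Proof. by rewrite gcomp1m gcompm1. Qed.

Definition L_ob (x : A) : M := MOb (gid (F x)).
Definition L_map (x y : A) (a : ghom x y) : ghom (L_ob x) (L_ob y) :=
  MHom (u := L_ob x) (v := L_ob y) (L_sq a).

Lemma L1 x : L_map (gid x) = gid (L_ob x).
Proof. by apply: M_hom_eq; rewrite //= gmap1. Qed.

Lemma LM x y z (g : ghom y z) (f : ghom x y) :
  L_map (g ∘ f) = L_map g ∘ L_map f.
Proof. by apply: M_hom_eq; rewrite //= gmapM. Qed.

Definition L : gfunctor A M := GFunctor L1 LM.

End MFunctor.

Section MMap.
Variables (A B A' B' : groupoid) (F : gfunctor A B) (F' : gfunctor A' B').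
Variables (H0 : gfunctor B B') (H1 : gfunctor A A') (e : H0 ⊙ F = F' ⊙ H1).

(* [H0 x] has target [H0 (F A)], which equals [F' (H1 A)] by [e]. *)
Definition M_map_ob (u : M F) : M F' :=
  MOb (F := F') (M_top := H1 (M_top u))
    (gidto (fob_eq e (M_top u)) ∘ gmap H0 (M_arr u)).

Lemma M_map_sq (u v : M F) (f : ghom u v) :
  M_arr (M_map_ob v) ∘ gmap H0 (M_hbot f)
  = gmap F' (gmap H1 (M_htop f)) ∘ M_arr (M_map_ob u).
Proof.
rewrite /= -gcompA -gmapM M_hsq gmapM !gcompA; congr (_ ∘ _).
exact: (fob_eq_nat e).
Qed.

Definition M_map_hom (u v : M F) (f : ghom u v) : ghom (M_map_ob u) (M_map_ob v) :=
  MHom (u := M_map_ob u) (v := M_map_ob v) (M_map_sq f).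

Lemma M_map1 u : M_map_hom (gid u) = gid (M_map_ob u).
Proof. by apply: M_hom_eq; rewrite /= gmap1. Qed.

Lemma M_mapM u v w (g : ghom v w) (f : ghom u v) :
  M_map_hom (g ∘ f) = M_map_hom g ∘ M_map_hom f.
Proof. by apply: M_hom_eq; rewrite /= gmapM. Qed.

Definition M_map : gfunctor (M F) (M F') := GFunctor M_map1 M_mapM.

End MMap.

Section Mu.
Variables (A B : groupoid) (F : gfunctor A B).

Definition mu_ob (u : M (R F)) : M F := MOb (M_arr (M_top u) ∘ M_arr u).

Lemma mu_sq (u v : M (R F)) (f : ghom u v) :
  M_arr (mu_ob v) ∘ M_hbot f = gmap F (M_htop (M_htop f)) ∘ M_arr (mu_ob u).
Proof. by rewrite /= -gcompA (M_hsq f) !gcompA /= (M_hsq (M_htop f)). Qed.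

Definition mu_map (u v : M (R F)) (f : ghom u v) : ghom (mu_ob u) (mu_ob v) :=
  MHom (u := mu_ob u) (v := mu_ob v) (mu_sq f).

Lemma mu1 u : mu_map (gid u) = gid (mu_ob u).
Proof. exact: M_hom_eq. Qed.

Lemma muM u v w (g : ghom v w) (f : ghom u v) :
  mu_map (g ∘ f) = mu_map g ∘ mu_map f.
Proof. exact: M_hom_eq. Qed.

Definition mu : gfunctor (M (R F)) (M F) := GFunctor mu1 muM.

End Mu.

(** * The category of R-algebras *)

Lemma str_sq (A B : groupoid) (F : gfunctor A B) (S : gfunctor (M F) A) :
  F ⊙ S = R F -> gfid B ⊙ R F = F ⊙ S.
Proof. by move=> ->; rewrite gfcomp1m. Qed.

Record ralg := RAlgebra {
  ra_dom : groupoid;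
  ra_cod : groupoid;
  ra_fun : gfunctor ra_dom ra_cod;
  ra_str : gfunctor (M ra_fun) ra_dom;
  ra_sec : ra_fun ⊙ ra_str = R ra_fun;
  ra_unit : ra_str ⊙ L ra_fun = gfid ra_dom;
  ra_mult : ra_str ⊙ M_map (str_sq ra_sec) = ra_str ⊙ mu ra_fun }.

Record ralg_hom (F F' : ralg) := RAlgHom {
  rh0 : gfunctor (ra_cod F) (ra_cod F');
  rh1 : gfunctor (ra_dom F) (ra_dom F');
  rh_sq : rh0 ⊙ ra_fun F = ra_fun F' ⊙ rh1;
  rh_str : rh1 ⊙ ra_str F = ra_str F' ⊙ M_map rh_sq }.

Lemma ralg_hom_eq (F F' : ralg) (h k : ralg_hom F F') :
  rh0 h = rh0 k -> rh1 h = rh1 k -> h = k.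
Proof.
case: h k => [h0 h1 s t] [k0 k1 s' t'] /= e0 e1; subst k0 k1.
move: t'; rewrite -(proof_irrelevance _ s s') => t'.
by rewrite (proof_irrelevance _ t t').
Qed.

Lemma M_ob_eq (A B : groupoid) (F : gfunctor A B) (a : A) (b : B)
    (x x' : ghom b (F a)) : x = x' -> MOb x = MOb x'.
Proof. by move=> ->. Qed.

Lemma M_gidto (A B : groupoid) (F : gfunctor A B) (u v : M F) (e : u = v) :
  M_hbot (gidto e : M_hom u v) = gidto (f_equal (@M_bot _ _ F) e) /\
  M_htop (gidto e : M_hom u v) = gidto (f_equal (@M_top _ _ F) e).
Proof. by case: v / e. Qed.

Lemma M_functor_ext (C A B : groupoid) (F : gfunctor A B)
    (G H : gfunctor C (M F))
    (et : forall x, M_top (G x) = M_top (H x))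
    (eb : forall x, M_bot (G x) = M_bot (H x)) :
  (forall x, gmap F (gidto (et x)) ∘ M_arr (G x)
             = M_arr (H x) ∘ gidto (eb x)) ->
  (forall x y (f : ghom x y),
     gidto (et y) ∘ M_htop (gmap G f) = M_htop (gmap H f) ∘ gidto (et x)) ->
  (forall x y (f : ghom x y),
     gidto (eb y) ∘ M_hbot (gmap G f) = M_hbot (gmap H f) ∘ gidto (eb x)) ->
  G = H.
Proof.
move=> ex ht hb.
have e x : G x = H x.
  move: (et x) (eb x) (ex x); case: (G x) (H x) => [a b k] [a' b' k'] /=.
  move=> ea eb'; subst a' b'; rewrite /= gmap1 gcomp1m gcompm1 => kk'.
  exact: M_ob_eq.
apply: (gfunctor_ext (e := e)) => x y f; apply: M_hom_eq => /=.
- rewrite (proj1 (M_gidto _)) (proj1 (M_gidto _)).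
  by rewrite !(proof_irrelevance _ (f_equal _ _) (eb _)).
- rewrite (proj2 (M_gidto _)) (proj2 (M_gidto _)).
  by rewrite !(proof_irrelevance _ (f_equal _ _) (et _)).
Qed.

Lemma M_map_id (A B : groupoid) (F : gfunctor A B)
    (e : gfid B ⊙ F = F ⊙ gfid A) : M_map e = gfid (M F).
Proof.
apply: (@M_functor_ext _ _ _ _ (M_map e) (gfid (M F))
          (fun _ => eq_refl) (fun _ => eq_refl)) => [u|u v f|u v f];
  rewrite /= ?gmap1 ?gcomp1m ?gcompm1 //.
by rewrite gidto_id gcomp1m.
Qed.

Lemma M_map_comp (A B A' B' A'' B'' : groupoid) (F : gfunctor A B)
    (F' : gfunctor A' B') (F'' : gfunctor A'' B'')
    (H0 : gfunctor B B') (H1 : gfunctor A A')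
    (K0 : gfunctor B' B'') (K1 : gfunctor A' A'')
    (e : H0 ⊙ F = F' ⊙ H1) (e' : K0 ⊙ F' = F'' ⊙ K1)
    (e'' : K0 ⊙ H0 ⊙ F = F'' ⊙ (K1 ⊙ H1)) :
  M_map e'' = M_map e' ⊙ M_map e.
Proof.
apply: (@M_functor_ext _ _ _ _ (M_map e'') (M_map e' ⊙ M_map e)
          (fun _ => eq_refl) (fun _ => eq_refl)) => [u|u v f|u v f];
  rewrite /= ?gmap1 ?gcomp1m ?gcompm1 //.
rewrite gmapM gcompA gmap_gidto gidto_comp.
by congr (gidto _ ∘ _); exact: proof_irrelevance.
Qed.

Lemma ralg_id_sq (F : ralg) :
  gfid (ra_cod F) ⊙ ra_fun F = ra_fun F ⊙ gfid (ra_dom F).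
Proof. by rewrite gfcomp1m gfcompm1. Qed.

Lemma ralg_id_str (F : ralg) :
  gfid (ra_dom F) ⊙ ra_str F = ra_str F ⊙ M_map (ralg_id_sq F).
Proof. by rewrite M_map_id gfcomp1m gfcompm1. Qed.

Definition ralg_id (F : ralg) : ralg_hom F F := RAlgHom (ralg_id_str F).

Section RAlgComp.
Variables (F F' F'' : ralg) (k : ralg_hom F' F'') (h : ralg_hom F F').

Lemma ralg_comp_sq :
  rh0 k ⊙ rh0 h ⊙ ra_fun F = ra_fun F'' ⊙ (rh1 k ⊙ rh1 h).
Proof. by rewrite -gfcompA rh_sq gfcompA rh_sq gfcompA. Qed.

Lemma ralg_comp_str :
  rh1 k ⊙ rh1 h ⊙ ra_str F = ra_str F'' ⊙ M_map ralg_comp_sq.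
Proof.
by rewrite (M_map_comp (rh_sq h) (rh_sq k)) -gfcompA rh_str gfcompA rh_str
   gfcompA.
Qed.

Definition ralg_comp : ralg_hom F F'' := RAlgHom ralg_comp_str.

End RAlgComp.

Lemma ralg_comp1m (F F' : ralg) (h : ralg_hom F F') :
  ralg_comp (ralg_id F') h = h.
Proof. by apply: ralg_hom_eq; rewrite /= gfcomp1m. Qed.

Lemma ralg_compm1 (F F' : ralg) (h : ralg_hom F F') :
  ralg_comp h (ralg_id F) = h.
Proof. by apply: ralg_hom_eq; rewrite /= gfcompm1. Qed.

Lemma ralg_compA (F F' F'' F''' : ralg) (l : ralg_hom F'' F''')
    (k : ralg_hom F' F'') (h : ralg_hom F F') :
  ralg_comp l (ralg_comp k h) = ralg_comp (ralg_comp l k) h.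
Proof. by apply: ralg_hom_eq; rewrite /= gfcompA. Qed.

Definition RAlg : category := Category ralg_comp1m ralg_compm1 ralg_compA.

Definition RAlg_base : functor RAlg Gpd :=
  {| fob := ra_cod : RAlg -> Gpd;
     fmap := rh0 : forall F F' : RAlg, hom F F' -> _;
     fmap1 := fun _ => eq_refl; fmapM := fun _ _ _ _ _ => eq_refl |}.

(* Main.v *)
(* Over the product X x X put the algebra Id X whose total groupoid is the arrow
   groupoid of X, with projection to the end points; its algebra structure is
   composition with the given arrows.  For A over Y x X, the left adjoint along
   pr122 sends A to pr12^* A /\ pr23^* (Id X), whose elements over (y, x, x') are
   an element a of A over (y, x) and an arrow between x and x'.  The structure of
   an algebra transports a along that arrow, and this transport, compatible with
   every morphism of algebras and trivial on identities, makes the arrow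
   a |-> (a, id) cocartesian.  More generally, an arrow A -> D over pr122 is
   cocartesian as soon as it has a retraction r : D -> A over pr12 and D carries
   s : D -> Id X over pr23 such that every element e of D is the transport along
   s(e) of the image of r(e).  This criterion is stable under reindexing
   (Beck-Chevalley) and under products with an algebra A' over Y x X x X
   (Frobenius), where A' is moved back along the inverse arrow.

   Cartesian lifts and products of fibres are both instances of strict pullbacks
   of finite families of algebras. *)

From Stdlib Require Import ssreflect.
From Stdlib Require Import FunctionalExtensionality ProofIrrelevance.
Require Import Defs.

Set Implicit Arguments.
Unset Strict Implicit.
Unset Printing Implicit Defensive.

Local Open Scope cat_scope.

(** * Maps between finite products and equations of their generalised elements *)

Section ProductLemmas.
Variables (B : category) (P : finite_products B).

Lemma cpair_ext (x a b : B) (f g : hom x (cprod P a b)) :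
  pr1 P a b ∘ f = pr1 P a b ∘ g -> pr2 P a b ∘ f = pr2 P a b ∘ g -> f = g.
Proof. by move=> e1 e2; rewrite (cpair_uniq P f) e1 e2 -cpair_uniq. Qed.

Definition pr23 (Y X : B) : hom (cprod P (cprod P Y X) X) (cprod P X X) :=
  cpair P (pr2 P Y X ∘ pr1 P (cprod P Y X) X) (pr2 P (cprod P Y X) X).

Definition pr13 (Y X : B) : hom (cprod P (cprod P Y X) X) (cprod P Y X) :=
  cpair P (pr1 P Y X ∘ pr1 P (cprod P Y X) X) (pr2 P (cprod P Y X) X).

Definition diagonal (X : B) : hom X (cprod P X X) := cpair P (idm X) (idm X).

Definition swap (X : B) : hom (cprod P X X) (cprod P X X) :=
  cpair P (pr2 P X X) (pr1 P X X).

End ProductLemmas.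

Ltac prod_simpl := rewrite /pr23 /pr13 /diagonal /swap /pr122 /prod_map;
  do ?[progress rewrite ?cpair_comp ?pr1_cpair ?pr2_cpair ?comp1m ?compm1 -?compA].
Ltac prod_eq := prod_simpl; try done;
  try (apply: cpair_ext; prod_eq).

Section PathBases.
Variables (B : category) (P : finite_products B) (W Y X : B).

Local Notation "Y × X" := (cprod P Y X) (at level 40, left associativity).

(** In elements [u] is [(y, x, x')], and the hypothesis forces [x = x']. This lemma and the three
    after it supply the equations of base arrows that put both sides of a law of transport over the
    same base arrow. *)
Lemma pr13_diagonal (u : hom W (Y × X × X)) (v : hom W X) :
  pr23 P Y X ∘ u = diagonal P X ∘ v -> pr13 P Y X ∘ u = pr1 P _ X ∘ u.
Proof.
move=> e; have e1 := f_equal (comp (pr1 P X X)) e.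
have e2 := f_equal (comp (pr2 P X X)) e; move: e1 e2; prod_simpl => e1 e2.
by apply: cpair_ext; prod_simpl; rewrite // e1 e2.
Qed.

Lemma pr13_diagonal_id (u : hom W (X × X × X)) (v : hom W X) :
  pr1 P _ X ∘ u = diagonal P X ∘ v -> pr13 P X X ∘ u = pr23 P X X ∘ u.
Proof.
move=> e; have e1 := f_equal (comp (pr1 P X X)) e.
have e2 := f_equal (comp (pr2 P X X)) e; move: e1 e2; prod_simpl => e1 e2.
by apply: cpair_ext; prod_simpl; rewrite // e1 e2.
Qed.

Lemma pr13_nat (Y' : B) (f : hom Y Y') (u : hom W (Y × X × X))
    (u' : hom W (Y' × X × X)) :
  pr1 P _ X ∘ u' = prod_map P f (idm X) ∘ (pr1 P _ X ∘ u) ->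
  pr23 P Y' X ∘ u' = pr23 P Y X ∘ u ->
  prod_map P f (idm X) ∘ (pr13 P Y X ∘ u) = pr13 P Y' X ∘ u'.
Proof.
move=> e e'; have e1 := f_equal (comp (pr1 P Y' X)) e.
have e2 := f_equal (comp (pr2 P X X)) e'; move: e1 e2; prod_simpl => e1 e2.
by apply: cpair_ext; prod_simpl; rewrite ?e1 ?e2.
Qed.

Lemma pr13_swap (u u' : hom W (Y × X × X)) :
  pr1 P _ X ∘ u' = pr13 P Y X ∘ u ->
  pr23 P Y X ∘ u = swap P X ∘ (pr23 P Y X ∘ u') ->
  pr13 P Y X ∘ u' = pr1 P _ X ∘ u.
Proof.
move=> e e'; have e1 := f_equal (comp (pr1 P Y X)) e.
have e2 := f_equal (comp (pr1 P X X)) e'; move: e1 e2; prod_simpl => e1 e2.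
by apply: cpair_ext; prod_simpl; rewrite ?e1 ?e2.
Qed.

End PathBases.

(** * Cleavage and fibred products from joint lifts *)

Section Over.
Variables (E B : category) (p : functor E B).

Lemma is_over_trans (X Y Z : B) (f : hom X Y) (f' : hom Y Z) (f'' : hom X Z)
    (a : fibre_ob p X) (b : fibre_ob p Y) (c : fibre_ob p Z)
    (g' : hom (fibre_val b) (fibre_val c)) (g : hom (fibre_val a) (fibre_val b)) :
  is_over f' g' -> is_over f g -> f' ∘ f = f'' -> is_over f'' (g' ∘ g).
Proof.
by move=> h' h <-; apply: (is_over_comp (HomOver h') (HomOver h)).
Qed.

(** Serves to read off equations of base arrows from equations of arrows above them. *)
Lemma is_over_base (X Y : B) (f f' : hom X Y) (a : fibre_ob p X) (b : fibre_ob p Y)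
    (g : hom (fibre_val a) (fibre_val b)) : is_over f g -> is_over f' g -> f = f'.
Proof.
case: a g => a ea; case: X / ea f f' => f f' g.
by rewrite /is_over /= !compm1 => -> ->.
Qed.

(** [over_raw] lets the base of a composite be inferred as the composite of the bases; [over] then
    compares it with the required base by [prod_eq]. *)
Ltac over_raw := lazymatch goal with
  | |- is_over _ (_ ∘ _) => eapply is_over_trans; [over_raw | over_raw | reflexivity]
  | |- is_over _ (over_val _) => exact: over_valP
  | |- _ => exact: is_over_id
  end.

Ltac over := lazymatch goal with
  | |- is_over _ (_ ∘ _) => eapply is_over_trans; [over_raw | over_raw | prod_eq]
  | |- _ => over_raw
  end.

Definition recast (X Y : B) (f f' : hom X Y) (a : fibre_ob p X) (b : fibre_ob p Y)
    (g : hom_over f a b) (e : f = f') : hom_over f' a b := over_cast e g.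

(* The joint analogue of a cartesian lift: unary families give cartesian
   lifts, families of identities give products in the fibres. *)
Record joint_lift (I : Type) (X : B) (Y : I -> B) (f : forall i, hom X (Y i))
    (b : forall i, fibre_ob p (Y i)) := JointLift {
  jl_ob : fibre_ob p X;
  jl_proj : forall i, hom_over (f i) jl_ob (b i);
  jl_factor : forall (W : B) (u : hom W X) (c : fibre_ob p W),
    (forall i, hom_over (f i ∘ u) c (b i)) -> hom_over u c jl_ob;
  jl_factorK : forall (W : B) (u : hom W X) (c : fibre_ob p W)
    (k : forall i, hom_over (f i ∘ u) c (b i)) i,
    over_val (jl_proj i) ∘ over_val (jl_factor k) = over_val (k i);
  jl_mono : forall (W : B) (u : hom W X) (c : fibre_ob p W)
    (h h' : hom_over u c jl_ob),
    (forall i, over_val (jl_proj i) ∘ over_val h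
               = over_val (jl_proj i) ∘ over_val h') -> h = h' }.

(** The joint lift of two legs. Uniqueness is stated for bare arrows with [is_over], so that it
    applies to composites without packaging them. *)
Record span_lift (X Y1 Y2 : B) (f1 : hom X Y1) (f2 : hom X Y2)
    (b1 : fibre_ob p Y1) (b2 : fibre_ob p Y2) := SpanLift {
  sl_ob : fibre_ob p X;
  sl_p1 : hom_over f1 sl_ob b1;
  sl_p2 : hom_over f2 sl_ob b2;
  sl_pair : forall (W : B) (u : hom W X) (c : fibre_ob p W),
    hom_over (f1 ∘ u) c b1 -> hom_over (f2 ∘ u) c b2 -> hom_over u c sl_ob;
  sl_pair1 : forall (W : B) (u : hom W X) (c : fibre_ob p W)
    (k1 : hom_over (f1 ∘ u) c b1) (k2 : hom_over (f2 ∘ u) c b2),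
    over_val sl_p1 ∘ over_val (sl_pair k1 k2) = over_val k1;
  sl_pair2 : forall (W : B) (u : hom W X) (c : fibre_ob p W)
    (k1 : hom_over (f1 ∘ u) c b1) (k2 : hom_over (f2 ∘ u) c b2),
    over_val sl_p2 ∘ over_val (sl_pair k1 k2) = over_val k2;
  sl_mono : forall (W : B) (u : hom W X) (c : fibre_ob p W)
    (h h' : hom (fibre_val c) (fibre_val sl_ob)),
    is_over u h -> is_over u h' ->
    over_val sl_p1 ∘ h = over_val sl_p1 ∘ h' ->
    over_val sl_p2 ∘ h = over_val sl_p2 ∘ h' -> h = h' }.

Definition has_joint_lifts : Type :=
  forall (I : Type) (X : B) (Y : I -> B) (f : forall i, hom X (Y i))
    (b : forall i, fibre_ob p (Y i)), joint_lift f b.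

Section FromJointLifts.
Variable J : has_joint_lifts.

Section Span.
Variables (X Y1 Y2 : B) (f1 : hom X Y1) (f2 : hom X Y2).
Variables (b1 : fibre_ob p Y1) (b2 : fibre_ob p Y2).

Let legs (i : bool) : hom X (if i then Y1 else Y2) :=
  if i as i return hom X (if i then Y1 else Y2) then f1 else f2.
Let ends (i : bool) : fibre_ob p (if i then Y1 else Y2) :=
  if i as i return fibre_ob p (if i then Y1 else Y2) then b1 else b2.
Let S := J legs ends.

Let pair (W : B) (u : hom W X) (c : fibre_ob p W)
    (k1 : hom_over (f1 ∘ u) c b1) (k2 : hom_over (f2 ∘ u) c b2) :
    forall i, hom_over (legs i ∘ u) c (ends i) :=
  fun i => if i as i return hom_over (legs i ∘ u) c (ends i) then k1 else k2.

Definition span_of : span_lift f1 f2 b1 b2.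
Proof.
refine (@SpanLift X Y1 Y2 f1 f2 b1 b2 (jl_ob S) (jl_proj S true) (jl_proj S false)
  (fun W u c k1 k2 => jl_factor S (pair k1 k2)) _ _ _).
- by move=> W u c k1 k2; rewrite (jl_factorK S (pair k1 k2) true).
- by move=> W u c k1 k2; rewrite (jl_factorK S (pair k1 k2) false).
- move=> W u c h h' o o' e1 e2.
  suff /(f_equal (fun k => over_val k)) : HomOver o = HomOver o' by [].
  by apply: (jl_mono (j := S)) => -[].
Qed.

End Span.

Definition cleavage_of : cleavage p.
Proof.
move=> X Y f b.
pose S := J (fun _ : Datatypes.unit => f) (fun _ => b).
refine (@CartesianLift E B p X Y f b (jl_ob S) (jl_proj S tt)
  (fun W u c k => jl_factor S (fun _ => k)) _ _).
- by move=> W u c k; apply: hom_over_eq; rewrite /= jl_factorK.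
- by move=> W u c h; apply: (jl_mono (j := S)) => -[]; rewrite jl_factorK.
Qed.

(** The joint lift of the empty family; the target [X] of the absent legs is an arbitrary choice. It
    is terminal for arrows over every base arrow, not only over identities. *)
Definition fibre_top (X : B) : fibre_ob p X :=
  jl_ob (J (fun i : Empty_set => match i return hom X X with end)
           (fun i => match i with end)).

Definition to_fibre_top (X W : B) (u : hom W X) (c : fibre_ob p W) :
    hom_over u c (fibre_top X) :=
  jl_factor (J _ _) (fun i : Empty_set => match i with end).

Lemma to_fibre_top_uniq (X W : B) (u : hom W X) (c : fibre_ob p W)
    (h h' : hom_over u c (fibre_top X)) : h = h'.
Proof. by apply: (jl_mono (j := J _ _)) => -[]. Qed.

Section FibreProducts.
Variable X : B.

Let S (a b : fibre_ob p X) := span_of (idm X) (idm X) a b.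

Definition fibre_pair (c a b : fibre p X) (f : hom c a) (g : hom c b) :
    hom c (sl_ob (S a b) : fibre p X) :=
  sl_pair (S a b) (recast f (eq_sym (comp1m _))) (recast g (eq_sym (comp1m _))).

Definition fibre_products : finite_products (fibre p X).
Proof.
refine (@FiniteProducts (fibre p X) (fibre_top X) (fun c => to_fibre_top (idm X) c)
  _ (fun a b => sl_ob (S a b)) (fun a b => sl_p1 (S a b)) (fun a b => sl_p2 (S a b))
  fibre_pair _ _ _).
- by move=> c f; apply: to_fibre_top_uniq.
- by move=> c a b f g; apply: hom_over_eq; rewrite /= sl_pair1.
- by move=> c a b f g; apply: hom_over_eq; rewrite /= sl_pair2.
- move=> c a b h; apply: hom_over_eq.
  by apply: (sl_mono (over_valP _) (over_valP _));
    rewrite /fibre_pair ?sl_pair1 ?sl_pair2.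
Defined.

End FibreProducts.

(** Joint lifts are universal for arrows over any base arrow. Two arrows into the reindexed factors
    are therefore composed with the cartesian arrows, paired over [f], and factored through the
    cartesian arrow of the product. *)
Lemma reindex_products (X Y : B) (f : hom X Y) :
  preserves_products (fibre_products Y) (reindex cleavage_of f).
Proof.
split=> [c|a b c g h].
- exists (factor (cleavage_of f (fibre_top Y)) (to_fibre_top (f ∘ idm X) c)).
  split=> // h' _; rewrite [RHS]factor_uniq; congr (factor _ _).
  exact: to_fibre_top_uniq.
- set S := span_of (idm Y) (idm Y) a b.
  pose ga := lift (cleavage_of f a); pose gb := lift (cleavage_of f b).
  pose gab := lift (cleavage_of f (sl_ob S)).
  have e : f ∘ idm X = idm Y ∘ (f ∘ idm X) by rewrite comp1m.
  pose k : hom_over (f ∘ idm X) c (sl_ob S) :=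
    sl_pair S (recast (over_comp ga g) e) (recast (over_comp gb h) e).
  pose l : hom c (reindex_ob cleavage_of f (sl_ob S)) := factor (cleavage_of f (sl_ob S)) k.
  have lE : over_val gab ∘ over_val l = over_val k.
    exact: (f_equal (fun z => over_val z) (factorK (cleavage_of f (sl_ob S)) k)).
  have fac (d : fibre_ob p Y) (u v : hom c (reindex_ob cleavage_of f d)) :
      over_val (lift (cleavage_of f d)) ∘ over_val u
      = over_val (lift (cleavage_of f d)) ∘ over_val v -> u = v.
    move=> euv; rewrite [u]factor_uniq [v]factor_uniq; congr (factor _ _).
    exact: hom_over_eq.
  exists l; split=> [|l' [e1 e2]].
    split; apply: fac; rewrite /= compA reindex_mapP -compA lE.
      by rewrite sl_pair1.
    by rewrite sl_pair2.
  apply: fac; rewrite -[LHS]/(over_val gab ∘ over_val l) lE.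
  apply: (sl_mono (over_valP k) (is_over_comp gab l')).
    rewrite sl_pair1 /= -e1 /= !compA.
    by rewrite reindex_mapP.
  rewrite sl_pair2 /= -e2 /= !compA.
  by rewrite reindex_mapP.
Qed.

End FromJointLifts.

(** * Cocartesian lifts and the left adjoint of reindexing *)

Section Cocartesian.
Variables (X Y : B) (f : hom X Y).

(** The weak form, which tests only arrows over [f] itself: this is the universal property that a
    left adjoint to reindexing along [f] provides. *)
Definition cocartesian (a : fibre_ob p X) (b : fibre_ob p Y) (d : hom_over f a b) : Prop :=
  forall (b' : fibre_ob p Y) (h : hom_over f a b'),
  exists! k : hom_over (idm Y) b b', over_val k ∘ over_val d = over_val h.

(** Factorisations are data, since the functor underlying the adjoint has to be constructed from
    them; uniqueness becomes right cancellation of [cl_arr]. *)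
Record cocartesian_lift (a : fibre_ob p X) := CocartesianLift {
  cl_ob : fibre_ob p Y;
  cl_arr : hom_over f a cl_ob;
  cl_factor : forall b : fibre_ob p Y, hom_over f a b -> hom_over (idm Y) cl_ob b;
  cl_factorK : forall (b : fibre_ob p Y) (h : hom_over f a b),
    over_val (cl_factor h) ∘ over_val cl_arr = over_val h;
  cl_epi : forall (b : fibre_ob p Y) (k k' : hom_over (idm Y) cl_ob b),
    over_val k ∘ over_val cl_arr = over_val k' ∘ over_val cl_arr -> k = k' }.

Variables (K : cleavage p) (T : forall a : fibre_ob p X, cocartesian_lift a).


Definition coreindex_map (a b : fibre p X) (g : hom a b) :
    hom (cl_ob (T a) : fibre p Y) (cl_ob (T b)) :=
  cl_factor (T a) (recast (over_comp (cl_arr (T b)) g) (compm1 f)).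

Lemma coreindex_mapP (a b : fibre p X) (g : hom a b) :
  over_val (coreindex_map g) ∘ over_val (cl_arr (T a))
  = over_val (cl_arr (T b)) ∘ over_val g.
Proof. exact: cl_factorK. Qed.

Lemma coreindex1 (a : fibre p X) : coreindex_map (idm a) = idm (cl_ob (T a) : fibre p Y).
Proof. by apply: cl_epi; rewrite coreindex_mapP /= comp1m compm1. Qed.

Lemma coreindexM (a b c : fibre p X) (h : hom b c) (g : hom a b) :
  coreindex_map (h ∘ g) = coreindex_map h ∘ coreindex_map g.
Proof.
apply: cl_epi; rewrite coreindex_mapP /= -compA coreindex_mapP.
by rewrite [RHS]compA coreindex_mapP compA.
Qed.

Definition coreindex : functor (fibre p X) (fibre p Y) :=
  Functor (fob := fun a : fibre p X => cl_ob (T a) : fibre p Y) coreindex1 coreindexM.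

Definition coreindex_unit (a : fibre p X) : hom a (reindex K f (coreindex a)) :=
  factor (K f (cl_ob (T a))) (recast (cl_arr (T a)) (eq_sym (compm1 f))).

Definition coreindex_counit (b : fibre p Y) : hom (coreindex (reindex K f b)) b :=
  cl_factor (T (reindex_ob K f b)) (lift (K f b)).

Lemma lift_mono (W : B) (u : hom W X) (c : fibre_ob p W) (b : fibre_ob p Y)
    (h h' : hom_over u c (lift_ob (K f b))) :
  over_val (lift (K f b)) ∘ over_val h = over_val (lift (K f b)) ∘ over_val h' ->
  h = h'.
Proof.
move=> e; rewrite [h]factor_uniq [h']factor_uniq; congr (factor _ _).
exact: hom_over_eq.
Qed.

Lemma lift_mono_raw (W : B) (u : hom W X) (c : fibre_ob p W) (b : fibre_ob p Y)
    (h h' : hom (fibre_val c) (fibre_val (lift_ob (K f b)))) :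
  is_over u h -> is_over u h' ->
  over_val (lift (K f b)) ∘ h = over_val (lift (K f b)) ∘ h' -> h = h'.
Proof.
move=> o o' e.
exact: (f_equal (fun k => over_val k) (@lift_mono _ _ _ _ (HomOver o) (HomOver o') e)).
Qed.

Lemma lift_factor (W : B) (u : hom W X) (c : fibre_ob p W) (b : fibre_ob p Y)
    (k : hom_over (f ∘ u) c b) :
  over_val (lift (K f b)) ∘ over_val (factor (K f b) k) = over_val k.
Proof. exact: (f_equal (fun k => over_val k) (factorK _ _)). Qed.

Lemma lift_coreindex_unit (a : fibre p X) :
  over_val (lift (K f (cl_ob (T a)))) ∘ over_val (coreindex_unit a)
  = over_val (cl_arr (T a)).
Proof. by rewrite lift_factor. Qed.

Lemma coreindex_counitP (b : fibre p Y) :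
  over_val (coreindex_counit b) ∘ over_val (cl_arr (T (reindex_ob K f b)))
  = over_val (lift (K f b)).
Proof. exact: cl_factorK. Qed.

(** Each law is tested either before a cocartesian arrow or after a cartesian one, where the unit
    and the counit become [cl_arr] and [lift]. *)
Definition coreindex_adjoint : left_adjoint (reindex K f).
Proof.
refine (@LeftAdjoint _ _ (reindex K f) coreindex coreindex_unit coreindex_counit
  _ _ _ _).
- move=> a a' g; apply: lift_mono.
  rewrite /= !compA reindex_mapP lift_coreindex_unit -[RHS]compA.
  by rewrite lift_coreindex_unit coreindex_mapP.
- move=> b b' g; apply: cl_epi.
  rewrite /= -!compA coreindex_mapP coreindex_counitP.
  by rewrite compA coreindex_counitP reindex_mapP.
- move=> a; apply: cl_epi.
  rewrite /= -compA coreindex_mapP compA coreindex_counitP.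
  by rewrite lift_coreindex_unit comp1m.
- move=> b; apply: lift_mono.
  rewrite /= compA reindex_mapP -compA lift_coreindex_unit.
  by rewrite coreindex_counitP compm1.
Defined.

Lemma transpose_coreindex (a : fibre p X) (b : fibre p Y) (g : hom a (reindex K f b)) :
  over_val (transpose coreindex_adjoint g) ∘ over_val (cl_arr (T a))
  = over_val (lift (K f b)) ∘ over_val g.
Proof.
by rewrite /= -compA coreindex_mapP compA coreindex_counitP.
Qed.

(** Cocartesian arrows out of the same object differ by an isomorphism. Frobenius and Beck-Chevalley
    both reduce to this: the composite of the canonical arrow with [cl_arr] is identified and shown
    to be cocartesian. *)
Lemma coreindex_iso (a : fibre p X) (b : fibre p Y) (k : hom (coreindex a) b)
    (d : hom_over f a b) :
  over_val k ∘ over_val (cl_arr (T a)) = over_val d -> cocartesian d -> is_iso k.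
Proof.
move=> kd dP; have [l [lP _]] := dP _ (cl_arr (T a)).
exists l; split.
  by apply: cl_epi; rewrite /= -compA kd lP comp1m.
(* [k] after [l] and the identity both fix [d], hence agree with the unique [m] that does. *)
have [m [_ mP]] := dP _ d.
transitivity m; last by apply: mP; rewrite /= comp1m.
by symmetry; apply: mP; rewrite /= -compA lP.
Qed.

End Cocartesian.

(** * Abstract transport and the criterion for cocartesian arrows *)

Section Transport.
Variables (J : has_joint_lifts) (P : finite_products B).

Local Notation "Y × X" := (cprod P Y X) (at level 40, left associativity).

(** The identity objects are a parameter [I] because the record below mentions these spans in its
    own fields. *)
Definition path_lift (I : forall X : B, fibre_ob p (X × X)) (Y X : B)
    (A : fibre_ob p (Y × X)) : span_lift (pr1 P (Y × X) X) (pr23 P Y X) A (I X) :=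
  span_of J _ _ _ _.

(* An element of [tr_id X] over [(x, x')] is to be thought of as an
   identification of [x] with [x'], along which [tr] transports.  The laws are
   stated for generalised elements of the object of pairs [path_lift]. *)
Record transport_structure := TransportStructure {
  tr_id : forall X : B, fibre_ob p (X × X);
  tr_refl : forall X : B, hom_over (diagonal P X) (fibre_top J X) (tr_id X);
  tr_sym : forall X : B, hom_over (swap P X) (tr_id X) (tr_id X);
  tr : forall (Y X : B) (A : fibre_ob p (Y × X)),
    hom_over (pr13 P Y X) (sl_ob (path_lift tr_id A)) A;
  tr_sym_refl : forall X : B,
    over_val (tr_sym X) ∘ over_val (tr_refl X) = over_val (tr_refl X);
  tr_on_refl : forall (Y X : B) (A : fibre_ob p (Y × X)) (W : B)
      (c : fibre_ob p W) (u : hom W (Y × X × X)) (v : hom W X)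
      (s : hom_over u c (sl_ob (path_lift tr_id A)))
      (z : hom_over v c (fibre_top J X)),
    over_val (sl_p2 (path_lift tr_id A)) ∘ over_val s
      = over_val (tr_refl X) ∘ over_val z ->
    over_val (tr A) ∘ over_val s
      = over_val (sl_p1 (path_lift tr_id A)) ∘ over_val s;
  tr_of_refl : forall (X W : B) (c : fibre_ob p W)
      (u : hom W (X × X × X)) (v : hom W X)
      (s : hom_over u c (sl_ob (path_lift tr_id (tr_id X))))
      (z : hom_over v c (fibre_top J X)),
    over_val (sl_p1 (path_lift tr_id (tr_id X))) ∘ over_val s
      = over_val (tr_refl X) ∘ over_val z ->
    over_val (tr (tr_id X)) ∘ over_val s
      = over_val (sl_p2 (path_lift tr_id (tr_id X))) ∘ over_val s;
  tr_nat : forall (Y Y' X : B) (f : hom Y Y') (A : fibre_ob p (Y × X))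
      (A' : fibre_ob p (Y' × X)) (w : hom_over (prod_map P f (idm X)) A A')
      (W : B) (c : fibre_ob p W) (u : hom W (Y × X × X)) (u' : hom W (Y' × X × X))
      (s : hom_over u c (sl_ob (path_lift tr_id A)))
      (s' : hom_over u' c (sl_ob (path_lift tr_id A'))),
    over_val (sl_p1 (path_lift tr_id A')) ∘ over_val s'
      = over_val w ∘ (over_val (sl_p1 (path_lift tr_id A)) ∘ over_val s) ->
    over_val (sl_p2 (path_lift tr_id A')) ∘ over_val s'
      = over_val (sl_p2 (path_lift tr_id A)) ∘ over_val s ->
    over_val w ∘ (over_val (tr A) ∘ over_val s) = over_val (tr A') ∘ over_val s';
  tr_const : forall (Y Z X : B) (g : hom Y Z) (A : fibre_ob p (Y × X))
      (C : fibre_ob p Z) (w : hom_over (g ∘ pr1 P Y X) A C)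
      (W : B) (c : fibre_ob p W) (u : hom W (Y × X × X))
      (s : hom_over u c (sl_ob (path_lift tr_id A))),
    over_val w ∘ (over_val (tr A) ∘ over_val s)
      = over_val w ∘ (over_val (sl_p1 (path_lift tr_id A)) ∘ over_val s);
  tr_symK : forall (Y X : B) (A : fibre_ob p (Y × X)) (W : B)
      (c : fibre_ob p W) (u u' : hom W (Y × X × X))
      (s : hom_over u c (sl_ob (path_lift tr_id A)))
      (s' : hom_over u' c (sl_ob (path_lift tr_id A))),
    over_val (sl_p1 (path_lift tr_id A)) ∘ over_val s'
      = over_val (tr A) ∘ over_val s ->
    over_val (sl_p2 (path_lift tr_id A)) ∘ over_val s
      = over_val (tr_sym X) ∘ (over_val (sl_p2 (path_lift tr_id A)) ∘ over_val s') ->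
    over_val (tr A) ∘ over_val s'
      = over_val (sl_p1 (path_lift tr_id A)) ∘ over_val s }.

Variable T : transport_structure.

Local Notation Id := (tr_id T).
Local Notation PL A := (path_lift (tr_id T) A).

Definition path_pair (Y X : B) (A : fibre_ob p (Y × X)) (W : B)
    (u : hom W (Y × X × X)) (c : fibre_ob p W)
    (g1 : hom W (Y × X)) (k1 : hom_over g1 c A) (e1 : g1 = pr1 P (Y × X) X ∘ u)
    (g2 : hom W (X × X)) (k2 : hom_over g2 c (Id X)) (e2 : g2 = pr23 P Y X ∘ u) :
    hom_over u c (sl_ob (PL A)) :=
  sl_pair (PL A) (recast k1 e1) (recast k2 e2).

Section Criterion.
Variables (Y X : B) (A : fibre_ob p (Y × X)) (D : fibre_ob p (Y × X × X)).
Variables (d : hom_over (pr122 P Y X) A D) (r : hom_over (pr1 P (Y × X) X) D A).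
Variables (s : hom_over (pr23 P Y X) D (Id X)).
Variable z : hom_over (pr2 P Y X) A (fibre_top J X).

Section Factor.
Variables (D' : fibre_ob p (Y × X × X)) (h : hom_over (pr122 P Y X) A D').

Lemma path_along1 : pr122 P Y X ∘ pr1 P (Y × X) X
  = pr1 P _ X ∘ prod_map P (pr122 P Y X) (idm X).
Proof. by prod_eq. Qed.

Lemma path_along2 : pr23 P Y X = pr23 P _ X ∘ prod_map P (pr122 P Y X) (idm X).
Proof. by prod_eq. Qed.

Lemma pr13_along : pr13 P _ X ∘ prod_map P (pr122 P Y X) (idm X) = idm _.
Proof. by prod_eq. Qed.

(** An element [e] of [D] over [(y, x, x')] goes to the pair of [h (r e)], over [(y, x, x)], and
    [s e]. Here [D'] is read over the product of [Y × X] with [X], so that transport moves its last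
    coordinate. *)
Definition path_along :
    hom_over (prod_map P (pr122 P Y X) (idm X)) D (sl_ob (PL D')) :=
  path_pair (over_comp h r) path_along1 s path_along2.

Lemma path_along_p1 :
  over_val (sl_p1 (PL D')) ∘ over_val path_along = over_val h ∘ over_val r.
Proof. exact: sl_pair1. Qed.

Lemma path_along_p2 : over_val (sl_p2 (PL D')) ∘ over_val path_along = over_val s.
Proof. exact: sl_pair2. Qed.

Definition path_factor : hom_over (idm _) D D' :=
  recast (over_comp (tr T D') path_along) pr13_along.

Hypothesis rd : over_val r ∘ over_val d = idm _.
Hypothesis sd : over_val s ∘ over_val d = over_val (tr_refl T X) ∘ over_val z.

(** On the image of [d] the path is reflexivity, so transport does nothing, and [r] undoes [d]. *)
Lemma path_factorK : over_val path_factor ∘ over_val d = over_val h.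
Proof.
rewrite /= -compA.
have /= -> := @tr_on_refl T _ _ D' _ _ _ _ (over_comp path_along d) z.
  by rewrite /= compA path_along_p2.
by rewrite compA path_along_p1 -compA rd compm1.
Qed.

End Factor.

Hypothesis rd : over_val r ∘ over_val d = idm _.
Hypothesis sd : over_val s ∘ over_val d = over_val (tr_refl T X) ∘ over_val z.
Hypothesis trd : over_val (tr T D) ∘ over_val (path_along d) = idm _.

(** By [trd] every element [e] of [D] is the transport of [d (r e)] along [s e]. Arrows commute with
    transport, so each is recovered from its composite with [d]. *)
Lemma path_factor_epi (D' : fibre_ob p (Y × X × X)) (k k' : hom_over (idm _) D D') :
  over_val k ∘ over_val d = over_val k' ∘ over_val d -> k = k'.
Proof.
have key (l : hom_over (idm _) D D') : over_val l =
    over_val (path_factor (recast (over_comp l d) (comp1m _))).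
  rewrite -[LHS]compm1 -trd.
  (* [tr_nat] asks for a base arrow that is a product with the identity of [X]. *)
  have e : idm (Y × X × X) = prod_map P (idm (Y × X)) (idm X) by prod_eq.
  rewrite (@tr_nat T _ _ _ _ _ _ (recast l e) _ _ _ _ (path_along d)
    (path_along (recast (over_comp l d) (comp1m _)))) //.
    by rewrite !path_along_p1 /= compA.
  by rewrite !path_along_p2.
move=> e; apply: hom_over_eq; rewrite [LHS]key [RHS]key.
by do 2 f_equal; apply: hom_over_eq.
Qed.

Lemma path_cocartesian : cocartesian d.
Proof.
move=> D' h; exists (path_factor h); split=> [|k kP]; first exact: path_factorK.
by apply: path_factor_epi; rewrite kP path_factorK.
Qed.

End Criterion.
Section Paths.
Variables (Y X : B) (A : fibre_ob p (Y × X)).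

Local Notation D := (sl_ob (PL A)).
Local Notation r := (sl_p1 (PL A)).
Local Notation s := (sl_p2 (PL A)).

Let z : hom_over (pr2 P Y X) A (fibre_top J X) := to_fibre_top J _ _.

Lemma refl_path1 : idm (Y × X) = pr1 P (Y × X) X ∘ pr122 P Y X.
Proof. by prod_eq. Qed.

Lemma refl_path2 : diagonal P X ∘ pr2 P Y X = pr23 P Y X ∘ pr122 P Y X.
Proof. by prod_eq. Qed.

Definition refl_path : hom_over (pr122 P Y X) A D :=
  path_pair (fibre_id A) refl_path1 (over_comp (tr_refl T X) z) refl_path2.

Lemma refl_path_p1 : over_val r ∘ over_val refl_path = idm _.
Proof. exact: sl_pair1. Qed.

Lemma refl_path_p2 (z' : hom_over (pr2 P Y X) A (fibre_top J X)) :
  over_val s ∘ over_val refl_path = over_val (tr_refl T X) ∘ over_val z'.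
Proof. by rewrite (to_fibre_top_uniq z' z); apply: sl_pair2. Qed.

(** This is the hypothesis [trd] of the criterion for [PL A] itself; it is checked on the two
    components of the pair. *)
Lemma tr_refl_path : over_val (tr T D) ∘ over_val (path_along r s refl_path) = idm _.
Proof.
pose t := over_comp (tr T D) (path_along r s refl_path).
have c1 : idm (Y × X) ∘ pr1 P (Y × X) X = pr1 P (Y × X) X by rewrite comp1m.
have c2 : pr23 P Y X = prod_map P (pr2 P Y X) (idm X) by prod_eq.
apply: (sl_mono (over_valP (recast t (pr13_along Y X)))
  (over_valP (fibre_id _))) => //=.
  (* [r] does not depend on the last coordinate, so transport leaves it fixed. *)
  rewrite (@tr_const T _ _ _ _ _ _ (recast r (eq_sym c1))) /=.
  rewrite path_along_p1 compA -[RHS]comp1m compm1.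
  by rewrite refl_path_p1.
pose sz := over_comp z r.
pose w : hom_over _ D (Id X) := recast s c2.
have e1 : diagonal P X ∘ (pr2 P Y X ∘ pr1 P (Y × X) X)
    = pr1 P (X × X) X ∘ prod_map P (pr23 P Y X) (idm X)
      ∘ prod_map P (pr122 P Y X) (idm X) by prod_eq.
have e2 : pr23 P Y X
    = pr23 P X X ∘ (prod_map P (pr23 P Y X) (idm X)
      ∘ prod_map P (pr122 P Y X) (idm X)) by prod_eq.
(* By naturality under [s], the second component is reflexivity transported along [s e], which is
   [s e] by [tr_of_refl]. *)
pose s' := path_pair (over_comp (tr_refl T X) sz) (eq_trans e1 (eq_sym (compA _ _ _)))
  s e2.
rewrite (@tr_nat T _ _ _ _ _ _ w _ _ _ _ _ s').
- by rewrite sl_pair1 path_along_p1 /= !compA (refl_path_p2 z).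
- by rewrite sl_pair2 path_along_p2.
- rewrite (@tr_of_refl T _ _ _ _ _ _ sz); first by rewrite sl_pair1.
  by rewrite sl_pair2 compm1.
Qed.

Definition path_cocartesian_lift : cocartesian_lift (pr122 P Y X) A.
Proof.
refine (@CocartesianLift _ _ (pr122 P Y X) A D refl_path
  (fun D' h => path_factor r s h) _ _).
- by move=> D' h; apply: (path_factorK _ refl_path_p1 (refl_path_p2 z)).
- by move=> D' k k'; apply: path_factor_epi tr_refl_path _ _ _.
Defined.

End Paths.
Local Notation K := (cleavage_of J).

Definition path_fibration : finite_products_fibration p :=
  @FiniteProductsFibration E B p K P (@fibre_products J) (@reindex_products J).

Definition path_adjoint (Y X : B) : left_adjoint (reindex K (pr122 P Y X)) :=
  coreindex_adjoint K (@path_cocartesian_lift Y X).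

(** * Frobenius reciprocity *)

Section Frobenius.
Variables (Y X : B) (A : fibre_ob p (Y × X)) (A' : fibre_ob p (Y × X × X)).

Local Notation dg := (pr122 P Y X).
Local Notation D := (sl_ob (PL A)).
Local Notation d := (refl_path A).
Local Notation r := (sl_p1 (PL A)).
Local Notation s := (sl_p2 (PL A)).
Let S1 := span_of J (idm (Y × X)) (idm _) (reindex_ob K dg A') A.
Let S2 := span_of J (idm (Y × X × X)) (idm _) A' D.
Let cart : hom_over dg (reindex_ob K dg A') A' := lift (K dg A').

Let commute1 (W Z : B) (f : hom W Z) : f ∘ idm W = idm Z ∘ f.
Proof. by rewrite comp1m compm1. Qed.

(** In elements, [(a', a)] over [(y, x)] goes to [(a', (a, refl x))] over [(y, x, x)]. *)
Definition frobenius_diagonal : hom_over dg (sl_ob S1) (sl_ob S2) :=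
  sl_pair S2 (recast (over_comp cart (sl_p1 S1)) (commute1 _))
    (recast (over_comp d (sl_p2 S1)) (commute1 _)).

Lemma frobenius_diagonal1 : over_val (sl_p1 S2) ∘ over_val frobenius_diagonal
  = over_val cart ∘ over_val (sl_p1 S1).
Proof. exact: sl_pair1. Qed.

Lemma frobenius_diagonal2 : over_val (sl_p2 S2) ∘ over_val frobenius_diagonal
  = over_val d ∘ over_val (sl_p2 S1).
Proof. exact: sl_pair2. Qed.

(* The element [a'] of [A'] over [(y, x, x')] is brought over [(y, x, x)]
   along the inverse of the identification of [x] with [x']. *)
Let swapped : hom (Y × X × X) (Y × X × X × X) :=
  cpair P (idm _) (pr2 P Y X ∘ pr1 P (Y × X) X).

Let swapped2 : swap P X ∘ pr23 P Y X ∘ idm _ = pr23 P _ X ∘ swapped.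
Proof. by rewrite /swapped; prod_eq. Qed.

Let swapped1 : idm _ = pr1 P _ X ∘ swapped.
Proof. by rewrite /swapped; prod_eq. Qed.

Let back : hom_over swapped (sl_ob S2) (sl_ob (PL A')) :=
  path_pair (sl_p1 S2) swapped1
    (over_comp (over_comp (tr_sym T X) s) (sl_p2 S2)) swapped2.

Let pr13_swapped : pr13 P _ X ∘ swapped = dg ∘ pr1 P (Y × X) X.
Proof. by rewrite /swapped; prod_eq. Qed.

Let moved : hom_over (dg ∘ pr1 P (Y × X) X) (sl_ob S2) A' :=
  recast (over_comp (tr T A') back) pr13_swapped.

(** In elements, [(a', (a, i))] goes to [a'] moved back along the inverse of [i], paired with
    [a]. *)
Let retraction : hom_over (pr1 P (Y × X) X) (sl_ob S2) (sl_ob S1) :=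
  sl_pair S1 (recast (factor (K dg A') moved) (eq_sym (comp1m _)))
    (recast (over_comp r (sl_p2 S2)) (commute1 _)).

Let retraction1 : over_val cart ∘ (over_val (sl_p1 S1) ∘ over_val retraction)
  = over_val moved.
Proof. by rewrite sl_pair1 lift_factor. Qed.

Let retraction2 : over_val (sl_p2 S1) ∘ over_val retraction
  = over_val r ∘ over_val (sl_p2 S2).
Proof. exact: sl_pair2. Qed.

Let path : hom_over (pr23 P Y X) (sl_ob S2) (Id X) :=
  recast (over_comp s (sl_p2 S2)) (compm1 _).

Let z : hom_over (pr2 P Y X) (sl_ob S1) (fibre_top J X) := to_fibre_top J _ _.
Let zA : hom_over (pr2 P Y X) A (fibre_top J X) := to_fibre_top J _ _.

Let zE : over_val zA ∘ over_val (sl_p2 S1) = over_val z.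
Proof.
apply: (f_equal (fun k => over_val k)
  (to_fibre_top_uniq (recast (over_comp zA (sl_p2 S1)) (compm1 _)) z)).
Qed.

Let path_diagonal :
  over_val path ∘ over_val frobenius_diagonal = over_val (tr_refl T X) ∘ over_val z.
Proof.
rewrite /= -compA frobenius_diagonal2 compA (refl_path_p2 zA).
by rewrite -zE compA.
Qed.

Let back1 : over_val (sl_p1 (PL A')) ∘ over_val back = over_val (sl_p1 S2).
Proof. exact: sl_pair1. Qed.

Let back2 : over_val (sl_p2 (PL A')) ∘ over_val back
  = over_val (tr_sym T X) ∘ over_val path.
Proof. by rewrite sl_pair2 /= compA. Qed.

(** The inverse of reflexivity is reflexivity, so nothing is moved. *)
Let moved_diagonal : over_val moved ∘ over_val frobenius_diagonal
  = over_val cart ∘ over_val (sl_p1 S1).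
Proof.
rewrite /= -compA.
have /= -> := @tr_on_refl T _ _ A' _ _ _ _ (over_comp back frobenius_diagonal) z.
  by rewrite /= compA back2 -compA path_diagonal compA tr_sym_refl.
by rewrite compA back1 frobenius_diagonal1.
Qed.

Let retraction_diagonal : over_val retraction ∘ over_val frobenius_diagonal = idm _.
Proof.
have over1 : is_over (idm _) (over_val retraction ∘ over_val frobenius_diagonal).
  by over.
apply: (sl_mono over1 (is_over_id _)).
  apply: (lift_mono_raw (u := idm _)); [by over|by over|].
  by rewrite compm1 -moved_diagonal -retraction1 !compA.
rewrite compm1 compA retraction2 -compA frobenius_diagonal2 compA.
by rewrite refl_path_p1 comp1m.
Qed.

Let along := path_along retraction path frobenius_diagonal.

Let idm_prod : idm (Y × X × X) = prod_map P (idm (Y × X)) (idm X).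
Proof. by prod_eq. Qed.

Let along1 : over_val (sl_p1 S2) ∘ (over_val (tr T _) ∘ over_val along)
  = over_val (sl_p1 S2).
Proof.
pose q := path_pair moved (path_along1 Y X) path (path_along2 Y X).
rewrite (@tr_nat T _ _ _ _ _ _ (recast (sl_p1 S2) idm_prod) _ _ _ _ _ q).
- by rewrite sl_pair1 path_along_p1 -retraction1 !compA /= frobenius_diagonal1.
- by rewrite sl_pair2 path_along_p2.
(* Transport along [path] undoes the earlier transport along its inverse. *)
- rewrite (@tr_symK T _ _ _ _ _ _ _ back q) ?back1 //.
    by rewrite sl_pair1.
  by rewrite back2 sl_pair2.
Qed.

(** By naturality under [sl_p2 S2] this becomes the case of [PL A], settled by [tr_refl_path]. *)
Let along2 : over_val (sl_p2 S2) ∘ (over_val (tr T _) ∘ over_val along)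
  = over_val (sl_p2 S2).
Proof.
pose q := over_comp (path_along r s d) (sl_p2 S2).
rewrite (@tr_nat T _ _ _ _ _ _ (recast (sl_p2 S2) idm_prod) _ _ _ _ _ q).
- rewrite /q /= compA !path_along_p1 -compA -retraction2.
  by rewrite !compA frobenius_diagonal2.
- by rewrite /q /= compA !path_along_p2.
- by rewrite /q /= compA tr_refl_path comp1m.
Qed.

Lemma frobenius_cocartesian : cocartesian frobenius_diagonal.
Proof.
apply: (path_cocartesian (r := retraction) (s := path) (z := z)) => //.
have over2 : is_over (idm _) (over_val (tr T _) ∘ over_val along) by over.
by apply: (sl_mono over2 (is_over_id _)); rewrite compm1.
Qed.

End Frobenius.

(** Composed with [cl_arr], the canonical arrow is [frobenius_diagonal], as is seen on both
    components. *)
Lemma frobenius_iso (Y X : B) (A : fibre p (Y × X)) (A' : fibre p (Y × X × X)) :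
  is_iso (frobenius_arrow (P := path_fibration) (path_adjoint Y X) A A').
Proof.
apply: (coreindex_iso _ (@frobenius_cocartesian Y X A A')).
have over1 : is_over (pr122 P Y X)
  (over_val (frobenius_arrow (P := path_fibration) (path_adjoint Y X) A A')
   ∘ over_val (cl_arr (path_cocartesian_lift
       (cprod (fibre_prod path_fibration (Y × X))
          (reindex (cleav path_fibration) (pr122 P Y X) A') A)))) by over.
apply: (sl_mono over1 (over_valP _)).
  rewrite [RHS]frobenius_diagonal1 [in LHS]compA
    -[RHS](transpose_coreindex (@path_cocartesian_lift Y X)).
  by congr (_ ∘ _); apply: sl_pair1.
rewrite [RHS]frobenius_diagonal2 [in LHS]compA
  -[RHS](coreindex_mapP (@path_cocartesian_lift Y X)).
by congr (_ ∘ _); apply: sl_pair2.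
Qed.

(** * The Beck-Chevalley condition *)

Section BeckChevalley.
Variables (Y Z X : B) (f : hom Y Z) (A : fibre_ob p (Z × X)).

Let fX := prod_map P f (idm X).
Let fXX := prod_map P fX (idm X).
Local Notation D := (sl_ob (PL A)).
Local Notation d := (refl_path A).
Local Notation r := (sl_p1 (PL A)).
Local Notation s := (sl_p2 (PL A)).
Let cA : hom_over fX (reindex_ob K fX A) A := lift (K fX A).
Let cD : hom_over fXX (reindex_ob K fXX D) D := lift (K fXX D).

Let base1 : pr122 P Z X ∘ fX = fXX ∘ pr122 P Y X.
Proof. exact: pr122_nat. Qed.

Definition bc_diagonal : hom_over (pr122 P Y X) (reindex_ob K fX A) (reindex_ob K fXX D) :=
  factor (K fXX D) (recast (over_comp d cA) base1).

Lemma bc_diagonalP : over_val cD ∘ over_val bc_diagonal = over_val d ∘ over_val cA.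
Proof. exact: lift_factor. Qed.

Let base2 : pr1 P (Z × X) X ∘ fXX = fX ∘ pr1 P (Y × X) X.
Proof. by rewrite /fXX /fX; prod_eq. Qed.

Let retraction : hom_over (pr1 P (Y × X) X) (reindex_ob K fXX D) (reindex_ob K fX A) :=
  factor (K fX A) (recast (over_comp r cD) base2).

Let retractionP : over_val cA ∘ over_val retraction = over_val r ∘ over_val cD.
Proof. exact: lift_factor. Qed.

Let base3 : pr23 P Z X ∘ fXX = pr23 P Y X.
Proof. by rewrite /fXX /fX; prod_eq. Qed.

Let path : hom_over (pr23 P Y X) (reindex_ob K fXX D) (Id X) :=
  recast (over_comp s cD) base3.

Let z : hom_over (pr2 P Y X) (reindex_ob K fX A) (fibre_top J X) := to_fibre_top J _ _.
Let zA : hom_over (pr2 P Z X) A (fibre_top J X) := to_fibre_top J _ _.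

Let base4 : pr2 P Z X ∘ fX = pr2 P Y X.
Proof. by rewrite /fX; prod_eq. Qed.

Let zE : over_val zA ∘ over_val cA = over_val z.
Proof.
exact: (f_equal (fun k => over_val k)
  (to_fibre_top_uniq (recast (over_comp zA cA) base4) z)).
Qed.

Let along := path_along retraction path bc_diagonal.

(** The retraction and the path come from those of [PL A] by reindexing. Through the cartesian
    arrows [cA] and [cD], each hypothesis of the criterion reduces to the corresponding fact about
    [refl_path A]. *)
Lemma bc_cocartesian : cocartesian bc_diagonal.
Proof.
apply: (path_cocartesian (r := retraction) (s := path) (z := z)) => //.
- apply: (lift_mono_raw (u := idm _)); [by over|by over|].
  rewrite [in LHS]compA retractionP -compA bc_diagonalP compA refl_path_p1.
  by rewrite comp1m compm1.
- by rewrite /= -compA bc_diagonalP compA (refl_path_p2 zA) -compA zE.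
- apply: (lift_mono_raw (u := idm _)); [by over|by over|].
  pose q := over_comp (path_along r s d) cD.
  (* [cD] lies over a product with the identity of [X], so it commutes with transport. *)
  rewrite (@tr_nat T _ _ _ _ _ _ cD _ _ _ _ _ q).
  + rewrite /q /= compA !path_along_p1 -compA -retractionP.
    by rewrite !compA bc_diagonalP.
  + by rewrite /q /= compA !path_along_p2.
  + by rewrite /q /= compA tr_refl_path comp1m compm1.
Qed.

End BeckChevalley.

(** The canonical arrow is the transpose of two successive factorisations; once they are undone, its
    composite with [cl_arr] is [bc_diagonal]. *)
Lemma beck_chevalley_iso (Y Z X : B) (f : hom Y Z) (A : fibre p (Z × X)) :
  is_iso (beck_chevalley_arrow (P := path_fibration) f
    (path_adjoint Y X) (path_adjoint Z X) A).
Proof.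
apply: (coreindex_iso _ (@bc_cocartesian Y Z X f A)).
rewrite [LHS]transpose_coreindex lift_factor.
apply: (lift_mono_raw (u := pr122 P Y X)); [by over|by over|].
rewrite [RHS]bc_diagonalP lift_factor; congr (_ ∘ _).
exact: (lift_coreindex_unit K (@path_cocartesian_lift Z X)).
Qed.

Lemma transport_elementary : elementary_fibration p.
Proof.
exists path_fibration; exists path_adjoint; split.
- by move=> Y X A A'; apply: frobenius_iso.
- by move=> Y Z X f A; apply: beck_chevalley_iso.
Qed.

End Transport.
End Over.

Local Close Scope cat_scope.
Local Open Scope gpd_scope.

(** * Inverses in groupoids and equality of functors *)

Section GroupoidLemmas.

Lemma ginvE (A : groupoid) (x y : A) (f : ghom x y) (g : ghom y x) :
  g ∘ f = gid x -> g = ginv f.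
Proof. by move=> e; rewrite -[LHS]gcompm1 -(gcompmV f) gcompA e gcomp1m. Qed.

Lemma gmapV (A B : groupoid) (F : gfunctor A B) (x y : A) (f : ghom x y) :
  gmap F (ginv f) = ginv (gmap F f).
Proof. by apply: ginvE; rewrite -gmapM gcompVm gmap1. Qed.

Lemma gcompKm (A : groupoid) (x y z : A) (f : ghom x y) (g : ghom y z) :
  ginv g ∘ (g ∘ f) = f.
Proof. by rewrite gcompA gcompVm gcomp1m. Qed.

Lemma gcompmK (A : groupoid) (x y z : A) (f : ghom x y) (g : ghom z x) :
  f ∘ g ∘ ginv g = f.
Proof. by rewrite -gcompA gcompmV gcompm1. Qed.

Lemma gsquareV (A : groupoid) (x y z w : A) (f : ghom x y) (g : ghom y w)
    (h : ghom x z) (k : ghom z w) :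
  g ∘ f = k ∘ h -> h ∘ ginv f = ginv k ∘ g.
Proof. by move=> e; rewrite -[RHS](gcompmK _ f) -(gcompA _ g) e gcompKm. Qed.

Lemma ginv_id (A : groupoid) (x : A) : ginv (gid x) = gid x.
Proof. by symmetry; apply: ginvE; rewrite gcomp1m. Qed.

Lemma ginvM (A : groupoid) (x y z : A) (g : ghom y z) (f : ghom x y) :
  ginv (g ∘ f) = ginv f ∘ ginv g.
Proof. by symmetry; apply: ginvE; rewrite -gcompA gcompKm gcompVm. Qed.

Lemma ginvK (A : groupoid) (x y : A) (f : ghom x y) : ginv (ginv f) = f.
Proof. by symmetry; apply: ginvE; rewrite gcompmV. Qed.

Lemma gidtoV (A : groupoid) (x y : A) (e : x = y) : ginv (gidto e) = gidto (eq_sym e).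
Proof. by case: y / e; apply: ginv_id. Qed.

(* Equality of functors is tested along jointly injective and faithful
   families, so that the arrows [gidto] need not be handled every time. *)
Lemma gfunctor_joint_mono (J : Type) (C A : groupoid) (X : J -> groupoid)
    (Q : forall j, gfunctor A (X j)) :
  (forall x y : A, (forall j, Q j x = Q j y) -> x = y) ->
  (forall (x y : A) (f g : ghom x y), (forall j, gmap (Q j) f = gmap (Q j) g) -> f = g) ->
  forall G H : gfunctor C A, (forall j, Q j ⊙ G = Q j ⊙ H) -> G = H.
Proof.
move=> inj faith G H e.
have eo x : G x = H x by apply: inj => j; apply: (fob_eq (e j)).
apply: (gfunctor_ext (e := eo)) => x y f; apply: faith => j.
rewrite !gmapM !gmap_gidto (proof_irrelevance _ (f_equal _ (eo y)) (fob_eq (e j) y)).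
rewrite (proof_irrelevance _ (f_equal _ (eo x)) (fob_eq (e j) x)).
exact: (fob_eq_nat (e j)).
Qed.

End GroupoidLemmas.

Ltac gfunctor_refl :=
  lazymatch goal with |- ?F = ?G =>
    apply: (@gfunctor_ext _ _ F G (fun _ => eq_refl)) => * /=;
    rewrite gcomp1m gcompm1; try done
  end.

(** * Naturality of the data of the monad *)

Section MLemmas.
Variables (A B A' B' : groupoid) (F : gfunctor A B) (F' : gfunctor A' B').
Variables (H0 : gfunctor B B') (H1 : gfunctor A A') (e : H0 ⊙ F = F' ⊙ H1).

Lemma M_map_eq (K0 : gfunctor B B') (K1 : gfunctor A A') (e' : K0 ⊙ F = F' ⊙ K1) :
  H0 = K0 -> H1 = K1 -> M_map e = M_map e'.
Proof. by move=> e0 e1; subst K0 K1; rewrite (proof_irrelevance _ e e'). Qed.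

Lemma R_nat : R F' ⊙ M_map e = H0 ⊙ R F.
Proof. gfunctor_refl. Qed.

Lemma L_nat : M_map e ⊙ L F = L F' ⊙ H1.
Proof.
apply: (@M_functor_ext _ _ _ _ (M_map e ⊙ L F) (L F' ⊙ H1)
  (fun _ => eq_refl) (fob_eq e)) => [x|x y f|x y f] /=.
- by rewrite !gmap1 gcompm1 !gcomp1m.
- by rewrite gcomp1m gcompm1.
- exact: (fob_eq_nat e).
Qed.

Lemma mu_nat (e' : H0 ⊙ R F = R F' ⊙ M_map e) :
  mu F' ⊙ M_map e' = M_map e ⊙ mu F.
Proof.
apply: (@M_functor_ext _ _ _ _ (mu F' ⊙ M_map e') (M_map e ⊙ mu F)
  (fun _ => eq_refl) (fun _ => eq_refl)) => [x|x y f|x y f];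
  rewrite /= ?gmap1 ?gcomp1m ?gcompm1 //.
by rewrite gidto_id gcomp1m gmapM gcompA.
Qed.

End MLemmas.

(** * Algebras over a fixed groupoid *)

Record alg (B : groupoid) := Alg {
  alg_dom : groupoid;
  alg_fun : gfunctor alg_dom B;
  alg_str : gfunctor (M alg_fun) alg_dom;
  alg_sec : alg_fun ⊙ alg_str = R alg_fun;
  alg_unit : alg_str ⊙ L alg_fun = gfid alg_dom;
  alg_mult : alg_str ⊙ M_map (str_sq alg_sec) = alg_str ⊙ mu alg_fun }.

Local Notation fib B := (fibre_ob RAlg_base B).

Definition ralg_of (B : groupoid) (a : alg B) : ralg :=
  RAlgebra (alg_unit a) (alg_mult a).

Definition canon (B : groupoid) (a : alg B) : fib B :=
  @FibreOb RAlg Gpd RAlg_base B (ralg_of a) eq_refl.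

(* The match is pushed inside the components, so that the domain of [alg_of b]
   is convertible to that of [b]. *)
Section AlgOf.
Variable v : ralg.

Definition cast_fun (B : groupoid) (e : ra_cod v = B) : gfunctor (ra_dom v) B :=
  match e in _ = C return gfunctor (ra_dom v) C with eq_refl => ra_fun v end.

Definition cast_str (B : groupoid) (e : ra_cod v = B) :
    gfunctor (M (cast_fun e)) (ra_dom v) :=
  match e as e' return gfunctor (M (cast_fun e')) (ra_dom v) with
  | eq_refl => ra_str v end.

Definition cast_sec (B : groupoid) (e : ra_cod v = B) :
    cast_fun e ⊙ cast_str e = R (cast_fun e) :=
  match e as e' return cast_fun e' ⊙ cast_str e' = R (cast_fun e') with
  | eq_refl => ra_sec v end.

Definition cast_unit (B : groupoid) (e : ra_cod v = B) :
    cast_str e ⊙ L (cast_fun e) = gfid _ :=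
  match e as e' return cast_str e' ⊙ L (cast_fun e') = gfid _ with
  | eq_refl => ra_unit v end.

Definition cast_mult (B : groupoid) (e : ra_cod v = B) :
    cast_str e ⊙ M_map (str_sq (cast_sec e)) = cast_str e ⊙ mu (cast_fun e) :=
  match e as e' return cast_str e' ⊙ M_map (str_sq (cast_sec e'))
                       = cast_str e' ⊙ mu (cast_fun e') with
  | eq_refl => ra_mult v end.

End AlgOf.

Definition alg_of (B : groupoid) (b : fib B) : alg B :=
  Alg (cast_unit (fibre_over b)) (cast_mult (fibre_over b)).

Lemma alg_ofK (B : groupoid) (b : fib B) : canon (alg_of b) = b.
Proof. by case: b => [[dom cod F S s u m] e]; case: B / e. Qed.

(** An object of a fibre may thus be assumed to have codomain [B] by conversion, and [is_over] then
    reduces to an equation between functors without [idto]. *)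
Lemma fib_rect (B : groupoid) (Q : fib B -> Type) :
  (forall a : alg B, Q (canon a)) -> forall b : fib B, Q b.
Proof. by move=> h b; rewrite -(alg_ofK b); apply: h. Qed.

Section AlgHom.
Variables (B B' : groupoid) (f : gfunctor B B') (a : alg B) (b : alg B').

Definition alg_hom (h : gfunctor (alg_dom a) (alg_dom b))
    (e : f ⊙ alg_fun a = alg_fun b ⊙ h)
    (s : h ⊙ alg_str a = alg_str b ⊙ M_map e) :
  hom_over (p := RAlg_base) (f : @hom Gpd B B') (canon a) (canon b).
Proof.
by exists (@RAlgHom (ralg_of a) (ralg_of b) f h e s); rewrite /is_over /= gfcomp1m gfcompm1.
Defined.

Lemma alg_over (g : ralg_hom (ralg_of a) (ralg_of b)) :
  is_over (p := RAlg_base) (f : @hom Gpd B B') (a := canon a) (b := canon b) g ->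
  rh0 g = f.
Proof. by rewrite /is_over /= gfcomp1m gfcompm1. Qed.

Lemma alg_over_sq (g : ralg_hom (ralg_of a) (ralg_of b)) :
  is_over (p := RAlg_base) (f : @hom Gpd B B') (a := canon a) (b := canon b) g ->
  f ⊙ alg_fun a = alg_fun b ⊙ rh1 g.
Proof. by move=> /alg_over <-; apply: (rh_sq g). Qed.

Lemma alg_over_eq (g g' : ralg_hom (ralg_of a) (ralg_of b)) :
  is_over (p := RAlg_base) (f : @hom Gpd B B') (a := canon a) (b := canon b) g ->
  is_over (p := RAlg_base) (f : @hom Gpd B B') (a := canon a) (b := canon b) g' ->
  rh1 g = rh1 g' -> g = g'.
Proof. by move=> /alg_over e /alg_over e'; apply: ralg_hom_eq; rewrite e e'. Qed.

End AlgHom.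

(** * Joint lifts of algebras *)

Section JointLift.
Variables (I : Type) (X : groupoid) (Y : I -> groupoid).
Variables (f : forall i, gfunctor X (Y i)) (a : forall i, alg (Y i)).

Local Notation A i := (alg_dom (a i)).
Local Notation F i := (alg_fun (a i)).

(** Compatibility is equality of objects, so this is the strict wide pullback of the [F i] along the
    [f i]. *)
Record jl_obj := JlObj {
  jl_base : X;
  jl_comp : forall i, A i;
  jl_over : forall i, F i (jl_comp i) = f i jl_base }.

Record jl_hom (u v : jl_obj) := JlHom {
  jh_base : ghom (jl_base u) (jl_base v);
  jh_comp : forall i, ghom (jl_comp u i) (jl_comp v i);
  jh_over : forall i, gidto (jl_over v i) ∘ gmap (F i) (jh_comp i)
                      = gmap (f i) jh_base ∘ gidto (jl_over u i) }.

Lemma jl_obj_eq (u v : jl_obj) :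
  jl_base u = jl_base v -> (forall i, jl_comp u i = jl_comp v i) -> u = v.
Proof.
case: u v => [x k e] [x' k' e'] /= ex ek; subst x'.
have ek' : k = k' by apply: functional_extensionality_dep.
by subst k'; rewrite (proof_irrelevance _ e e').
Qed.

Lemma jl_hom_eq (u v : jl_obj) (g h : jl_hom u v) :
  jh_base g = jh_base h -> (forall i, jh_comp g i = jh_comp h i) -> g = h.
Proof.
case: g h => [x k e] [x' k' e'] /= ex ek; subst x'.
have ek' : k = k' by apply: functional_extensionality_dep.
by subst k'; rewrite (proof_irrelevance _ e e').
Qed.

Definition jl_id (u : jl_obj) : jl_hom u u.
Proof.
exists (gid _) (fun i => gid _) => i.
by rewrite !gmap1 gcomp1m gcompm1.
Defined.

Definition jl_cmp (u v w : jl_obj) (g : jl_hom v w) (h : jl_hom u v) : jl_hom u w.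
Proof.
exists (jh_base g ∘ jh_base h) (fun i => jh_comp g i ∘ jh_comp h i) => i.
by rewrite !gmapM gcompA jh_over -gcompA jh_over gcompA.
Defined.

Definition jl_inv (u v : jl_obj) (g : jl_hom u v) : jl_hom v u.
Proof.
exists (ginv (jh_base g)) (fun i => ginv (jh_comp g i)) => i.
by rewrite !gmapV; apply: gsquareV; apply: jh_over.
Defined.

Definition jl_gpd : groupoid.
Proof.
refine (@Groupoid jl_obj jl_hom jl_id jl_cmp jl_inv _ _ _ _ _).
- by move=> u v g; apply: jl_hom_eq => *; rewrite /= gcomp1m.
- by move=> u v g; apply: jl_hom_eq => *; rewrite /= gcompm1.
- by move=> u v w z h g k; apply: jl_hom_eq => *; rewrite /= gcompA.
- by move=> u v g; apply: jl_hom_eq => *; rewrite /= gcompVm.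
- by move=> u v g; apply: jl_hom_eq => *; rewrite /= gcompmV.
Defined.

Definition jl_fun : gfunctor jl_gpd X :=
  @GFunctor jl_gpd X jl_base jh_base (fun _ => eq_refl) (fun _ _ _ _ _ => eq_refl).

Definition jl_leg (i : I) : gfunctor jl_gpd (A i) :=
  @GFunctor jl_gpd (A i) (fun u => jl_comp u i) (fun _ _ g => jh_comp g i)
    (fun _ => eq_refl) (fun _ _ _ _ _ => eq_refl).

Lemma jl_sq (i : I) : f i ⊙ jl_fun = F i ⊙ jl_leg i.
Proof.
symmetry; apply: (@gfunctor_ext _ _ (F i ⊙ jl_leg i) (f i ⊙ jl_fun)
  (fun u : jl_gpd => jl_over u i)) => u v g.
exact: (jh_over g).
Qed.

Section Mediating.
Variables (C : groupoid) (u : gfunctor C X) (k : forall i, gfunctor C (A i)).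
Variable e : forall i, F i ⊙ k i = f i ⊙ u.

Definition jl_med : gfunctor C jl_gpd.
Proof.
refine (@GFunctor C jl_gpd
  (fun x => @JlObj (u x) (fun i => k i x) (fun i => fob_eq (e i) x))
  (fun x y g => @JlHom (JlObj _) (JlObj _)
     (gmap u g) (fun i => gmap (k i) g) (fun i => fob_eq_nat (e i) g)) _ _).
- by move=> x; apply: jl_hom_eq => *; rewrite /= gmap1.
- by move=> x y z g h; apply: jl_hom_eq => *; rewrite /= gmapM.
Defined.

Lemma jl_fun_med : jl_fun ⊙ jl_med = u.
Proof. gfunctor_refl. Qed.

Lemma jl_leg_med i : jl_leg i ⊙ jl_med = k i.
Proof. gfunctor_refl. Qed.

End Mediating.

Lemma jl_joint_mono (C : groupoid) (G H : gfunctor C jl_gpd) :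
  jl_fun ⊙ G = jl_fun ⊙ H -> (forall i, jl_leg i ⊙ G = jl_leg i ⊙ H) -> G = H.
Proof.
move=> e0 e1.
apply: (@gfunctor_joint_mono (option I) C jl_gpd
  (fun j => if j is Some i then A i else X)
  (fun j => if j is Some i return gfunctor jl_gpd (if j is Some i then A i else X)
            then jl_leg i else jl_fun)).
- move=> x y exy; apply: jl_obj_eq; first exact: (exy None).
  by move=> i; apply: (exy (Some i)).
- move=> x y g h egh; apply: jl_hom_eq; first exact: (egh None).
  by move=> i; apply: (egh (Some i)).
- by case.
Qed.

Lemma jl_str_sq i : F i ⊙ (alg_str (a i) ⊙ M_map (jl_sq i)) = f i ⊙ R jl_fun.
Proof. by rewrite gfcompA alg_sec R_nat. Qed.

Definition jl_str : gfunctor (M jl_fun) jl_gpd := jl_med jl_str_sq.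

Lemma jl_leg_str i : jl_leg i ⊙ jl_str = alg_str (a i) ⊙ M_map (jl_sq i).
Proof. exact: jl_leg_med. Qed.

Lemma jl_sec : jl_fun ⊙ jl_str = R jl_fun.
Proof. exact: jl_fun_med. Qed.

Lemma jl_unit : jl_str ⊙ L jl_fun = gfid jl_gpd.
Proof.
apply: jl_joint_mono => [|i]; rewrite gfcompA ?jl_sec ?jl_leg_str gfcompm1.
  gfunctor_refl.
by rewrite -gfcompA L_nat gfcompA alg_unit gfcomp1m.
Qed.

(** Tested on the projections. On a leg, naturality of [mu] and the law of [a i] reduce the claim to
    [M_map] of two composite squares with equal sides. *)
Lemma jl_mult : jl_str ⊙ M_map (str_sq jl_sec) = jl_str ⊙ mu jl_fun.
Proof.
apply: jl_joint_mono => [|i]; rewrite !gfcompA ?jl_sec ?jl_leg_str.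
  by rewrite R_nat gfcomp1m; gfunctor_refl.
have e : f i ⊙ R jl_fun = R (F i) ⊙ M_map (jl_sq i) by rewrite R_nat.
rewrite -[RHS]gfcompA -(mu_nat e) gfcompA -alg_mult -!gfcompA.
congr (_ ⊙ _).
have e1 : f i ⊙ gfid X ⊙ R jl_fun = F i ⊙ (jl_leg i ⊙ jl_str).
  by rewrite jl_leg_str jl_str_sq gfcompm1.
have e2 : gfid (Y i) ⊙ f i ⊙ R jl_fun = F i ⊙ (alg_str (a i) ⊙ M_map (jl_sq i)).
  by rewrite jl_str_sq gfcomp1m.
rewrite -(M_map_comp _ _ e1) -(M_map_comp _ _ e2); apply: M_map_eq.
  by rewrite gfcomp1m gfcompm1.
exact: jl_leg_str.
Qed.

Definition jl_alg : alg X := Alg jl_unit jl_mult.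

End JointLift.

Section AlgJointLift.
Variables (I : Type) (X : groupoid) (Y : I -> groupoid).
Variables (f : forall i, gfunctor X (Y i)) (a : forall i, alg (Y i)).

Definition jl_alg_proj i :
    hom_over (p := RAlg_base) (f i : @hom Gpd X (Y i)) (canon (jl_alg f a)) (canon (a i)) :=
  alg_hom (a := jl_alg f a) (e := jl_sq f a i) (jl_leg_str f a i).

(** The reduction to a canonical [c] goes through the opaque [fib_rect], so the factor is delivered
    together with the equations that characterise it. *)
Lemma jl_alg_factor (W : groupoid) (u : @hom Gpd W X) (c : fib W)
    (k : forall i, hom_over ((f i : @hom Gpd X (Y i)) ∘ u)%cat c (canon (a i))) :
  { h : hom_over u c (canon (jl_alg f a)) |
    forall i, (over_val (jl_alg_proj i) ∘ over_val h)%cat = over_val (k i) }.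
Proof.
move: c k; apply: fib_rect => c k.
have k0 i : rh0 (over_val (k i)) = f i ⊙ u := alg_over (over_valP (k i)).
have e i : alg_fun (a i) ⊙ rh1 (over_val (k i)) = f i ⊙ (u ⊙ alg_fun c).
  by rewrite gfcompA; symmetry; apply: (alg_over_sq (over_valP (k i))).
pose m := jl_med e.
have sq : u ⊙ alg_fun c = jl_fun f a ⊙ m by rewrite jl_fun_med.
have str : m ⊙ alg_str c = jl_str f a ⊙ M_map sq.
  apply: jl_joint_mono => [|i]; rewrite !gfcompA.
    by rewrite jl_fun_med jl_sec R_nat -gfcompA alg_sec.
  rewrite jl_leg_med jl_leg_str -gfcompA.
  have e' : f i ⊙ u ⊙ alg_fun c = alg_fun (a i) ⊙ (jl_leg f a i ⊙ m).
    by rewrite jl_leg_med e gfcompA.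
  rewrite -(M_map_comp _ _ e').
  rewrite [LHS](rh_str (over_val (k i))); congr (_ ⊙ _).
  by apply: M_map_eq; [exact: k0 | rewrite jl_leg_med].
exists (alg_hom (a := c) (b := jl_alg f a) str) => i.
apply: ralg_hom_eq => /=; first by rewrite k0.
exact: jl_leg_med.
Qed.

Lemma jl_alg_mono (W : groupoid) (u : @hom Gpd W X) (c : fib W)
    (h h' : hom_over u c (canon (jl_alg f a))) :
  (forall i, over_val (jl_alg_proj i) ∘ over_val h
     = over_val (jl_alg_proj i) ∘ over_val h')%cat -> h = h'.
Proof.
move: c h h'; apply: fib_rect => c h h' e; apply: hom_over_eq.
apply: (alg_over_eq (over_valP h) (over_valP h')).
apply: jl_joint_mono => [|i]; last exact: (f_equal (fun g => rh1 g) (e i)).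
have sq (g : hom_over u (canon c) (canon (jl_alg f a))) :
    jl_fun f a ⊙ rh1 (over_val g) = u ⊙ alg_fun c.
  by symmetry; apply: (alg_over_sq (over_valP g)).
by rewrite !sq.
Qed.

End AlgJointLift.

Lemma ralg_joint_lifts : has_joint_lifts RAlg_base.
Proof.
move=> I X Y f b.
have -> : b = fun i => canon (alg_of (b i)).
  by apply: functional_extensionality_dep => i; rewrite alg_ofK.
exact: (JointLift (fun W u c k i => proj2_sig (jl_alg_factor k) i)
  (@jl_alg_mono I X Y f (fun i => alg_of (b i)))).
Qed.

(** * Products of groupoids *)

Set Primitive Projections.
(** Primitive projections give eta by conversion, so that functors into a product agree on objects
    by [eq_refl]. *)
Record gpair (A B : Type) := GPair { gfst : A; gsnd : B }.
Unset Primitive Projections.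

Definition gprod (A B : groupoid) : groupoid.
Proof.
refine (@Groupoid (gpair A B)
  (fun u v => gpair (ghom (gfst u) (gfst v)) (ghom (gsnd u) (gsnd v)))
  (fun u => GPair (gid _) (gid _))
  (fun u v w g f => GPair (gfst g ∘ gfst f) (gsnd g ∘ gsnd f))
  (fun u v f => GPair (ginv (gfst f)) (ginv (gsnd f))) _ _ _ _ _).
- by move=> u v f; rewrite !gcomp1m.
- by move=> u v f; rewrite !gcompm1.
- by move=> u v w z h g f; rewrite !gcompA.
- by move=> u v f; rewrite !gcompVm.
- by move=> u v f; rewrite !gcompmV.
Defined.

Definition gpr1 (A B : groupoid) : gfunctor (gprod A B) A :=
  @GFunctor (gprod A B) A (fun u => gfst u) (fun _ _ f => gfst f)
    (fun _ => eq_refl) (fun _ _ _ _ _ => eq_refl).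

Definition gpr2 (A B : groupoid) : gfunctor (gprod A B) B :=
  @GFunctor (gprod A B) B (fun u => gsnd u) (fun _ _ f => gsnd f)
    (fun _ => eq_refl) (fun _ _ _ _ _ => eq_refl).

Definition gpairing (C A B : groupoid) (F : gfunctor C A) (G : gfunctor C B) :
  gfunctor C (gprod A B).
Proof.
refine (@GFunctor C (gprod A B) (fun x => GPair (F x) (G x))
  (fun x y f => GPair (gmap F f) (gmap G f)) _ _).
- by move=> x; rewrite !gmap1.
- by move=> x y z g f; rewrite !gmapM.
Defined.

Definition gterm : groupoid.
Proof.
by refine (@Groupoid Datatypes.unit (fun _ _ => Datatypes.unit) (fun _ => tt)
  (fun _ _ _ _ _ => tt) (fun _ _ _ => tt) _ _ _ _ _) => // *;
  repeat match goal with f : Datatypes.unit |- _ => case: f end.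
Defined.

Definition to_gterm (C : groupoid) : gfunctor C gterm :=
  @GFunctor C gterm (fun _ => tt) (fun _ _ _ => tt)
    (fun _ => eq_refl) (fun _ _ _ _ _ => eq_refl).

Lemma to_gterm_uniq (C : groupoid) (F : gfunctor C gterm) : F = to_gterm C.
Proof.
have e x : F x = to_gterm C x by rewrite /=; case: (F x).
apply: (gfunctor_ext (e := e)) => x y f.
by case: (gmap (to_gterm C) f ∘ _); case: (_ ∘ gmap F f).
Qed.

Lemma gpr1_pairing (C A B : groupoid) (F : gfunctor C A) (G : gfunctor C B) :
  gpr1 A B ⊙ gpairing F G = F.
Proof. gfunctor_refl. Qed.

Lemma gpr2_pairing (C A B : groupoid) (F : gfunctor C A) (G : gfunctor C B) :
  gpr2 A B ⊙ gpairing F G = G.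
Proof. gfunctor_refl. Qed.

Lemma gpairing_uniq (C A B : groupoid) (H : gfunctor C (gprod A B)) :
  H = gpairing (gpr1 A B ⊙ H) (gpr2 A B ⊙ H).
Proof. by gfunctor_refl; rewrite !gcomp1m !gcompm1. Qed.

Definition gpd_products : finite_products Gpd :=
  @FiniteProducts Gpd gterm to_gterm to_gterm_uniq gprod gpr1 gpr2 gpairing
    gpr1_pairing gpr2_pairing gpairing_uniq.

Lemma gpair_gidto (A B : groupoid) (u v : gprod A B) (e : u = v) :
  gidto e = GPair (gidto (f_equal (@gfst A B) e)) (gidto (f_equal (@gsnd A B) e))
    :> ghom u v.
Proof. by case: v / e. Qed.

Lemma gpair_eq (A B : Type) (u v : gpair A B) :
  gfst u = gfst v -> gsnd u = gsnd v -> u = v.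
Proof. by case: u v => [a b] [a' b'] /= -> ->. Qed.

(** * Arrow groupoids *)

Ltac M_functor_refl :=
  lazymatch goal with |- ?F = ?G =>
    apply: (@M_functor_ext _ _ _ _ F G (fun _ => eq_refl) (fun _ => eq_refl)) => * /=;
    rewrite ?gmap1 ?gcomp1m ?gcompm1; try done
  end.

Section Arrows.
Variable X : groupoid.

Local Notation arr := (M (gfid X)).

(** An object of [arr] is an arrow from [M_bot] to [M_top]. Its target is the first end point
    because an algebra structure moves elements from the target of an arrow to its source. *)
Definition ends : gfunctor arr (gprod X X) :=
  @GFunctor arr (gprod X X) (fun u => GPair (M_top u) (M_bot u))
    (fun _ _ f => GPair (M_htop f) (M_hbot f))
    (fun _ => eq_refl) (fun _ _ _ _ _ => eq_refl).

(** An arrow [m], with [f] into its target and [g] into its source, becomes [f^-1 m g]. *)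
Definition ends_str_ob (u : M ends) : arr :=
  @MOb _ _ (gfid X) (gfst (M_bot u)) (gsnd (M_bot u))
    (ginv (gfst (M_arr u)) ∘ M_arr (M_top u) ∘ gsnd (M_arr u)).

Lemma ends_str_sq (u v : M ends) (f : ghom u v) :
  M_arr (ends_str_ob v) ∘ gsnd (M_hbot f)
  = gfst (M_hbot f) ∘ M_arr (ends_str_ob u).
Proof.
have e1 := f_equal (@gfst _ _) (M_hsq f); have e2 := f_equal (@gsnd _ _) (M_hsq f).
have e3 := M_hsq (M_htop f).
rewrite /= in e1 e2 e3 *.
rewrite -gcompA e2 !gcompA -[_ ∘ M_arr (M_top v) ∘ _]gcompA e3 !gcompA.
by rewrite (gsquareV (eq_sym e1)).
Qed.

Definition ends_str : gfunctor (M ends) arr.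
Proof.
refine (@GFunctor (M ends) arr ends_str_ob
  (fun u v f => @MHom _ _ (gfid X) (ends_str_ob u) (ends_str_ob v) _ _ (ends_str_sq f)) _ _).
- by move=> u; apply: M_hom_eq.
- by move=> u v w g f; apply: M_hom_eq.
Defined.

Lemma ends_sec : ends ⊙ ends_str = R ends.
Proof. by gfunctor_refl; rewrite gcomp1m gcompm1. Qed.

Lemma ends_unit : ends_str ⊙ L ends = gfid arr.
Proof. by M_functor_refl; rewrite ginv_id gcomp1m. Qed.

Lemma ends_mult : ends_str ⊙ M_map (str_sq ends_sec) = ends_str ⊙ mu ends.
Proof.
M_functor_refl; rewrite gidto_id /= !ginvM ginv_id !gcomp1m gcompm1.
by rewrite !gcompA.
Qed.

Definition ends_alg : alg (gprod X X) := Alg ends_unit ends_mult.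

Definition flip : gfunctor arr arr.
Proof.
refine (@GFunctor arr arr
  (fun u => @MOb _ _ (gfid X) (M_bot u) (M_top u) (ginv (M_arr u)))
  (fun u v f => @MHom _ _ (gfid X) (MOb _) (MOb _) (M_htop f) (M_hbot f) _) _ _).
- by move=> u; apply: M_hom_eq.
- by move=> u v w g f; apply: M_hom_eq.
Unshelve.
by symmetry; apply: gsquareV; symmetry; apply: (M_hsq f).
Defined.

Definition gswap : gfunctor (gprod X X) (gprod X X) :=
  gpairing (gpr2 X X) (gpr1 X X).

Lemma flip_sq : gswap ⊙ ends = ends ⊙ flip.
Proof. by gfunctor_refl; rewrite gcomp1m gcompm1. Qed.

Lemma flip_str : flip ⊙ ends_str = ends_str ⊙ M_map flip_sq.
Proof.
M_functor_refl; rewrite gidto_id /= !gcomp1m.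
by rewrite !ginvM ginvK !gcompA.
Qed.

Lemma flip_L : flip ⊙ L (gfid X) = L (gfid X).
Proof. by M_functor_refl; rewrite ginv_id. Qed.

Definition gdiag : gfunctor X (gprod X X) := gpairing (gfid X) (gfid X).

Section Refl.
Variable c : alg X.

Lemma refl_sq : gdiag ⊙ alg_fun c = ends ⊙ (L (gfid X) ⊙ alg_fun c).
Proof. by gfunctor_refl; rewrite gcomp1m gcompm1. Qed.

(** Over the diagonal both end points move along the same arrow, and conjugating an identity by it
    gives an identity. The algebra [c] is general because the terminal object of the fibre is known
    only by its universal property. *)
Lemma refl_str : L (gfid X) ⊙ alg_fun c ⊙ alg_str c = ends_str ⊙ M_map refl_sq.
Proof.
apply: (@M_functor_ext _ _ _ _ (L (gfid X) ⊙ alg_fun c ⊙ alg_str c)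
  (ends_str ⊙ M_map refl_sq) (fob_eq (alg_sec c)) (fob_eq (alg_sec c))) => [u|u v f|u v f].
- rewrite /= gidto_id /= !gcomp1m gcompm1.
  by rewrite gcompm1 gcompVm gcomp1m.
- exact: (fob_eq_nat (alg_sec c)).
- exact: (fob_eq_nat (alg_sec c)).
Qed.

End Refl.

End Arrows.

(** * Transport along arrows *)

Definition M_topf (A B : groupoid) (F : gfunctor A B) : gfunctor (M F) A :=
  @GFunctor (M F) A (fun u => M_top u) (fun _ _ f => M_htop f)
    (fun _ => eq_refl) (fun _ _ _ _ _ => eq_refl).

Section PathFunctor.
Variables (Y X A C : groupoid) (F : gfunctor A (gprod Y X)).
Variables (K : gfunctor C A) (N : gfunctor C (M (gfid X))).
Variable e : M_topf (gfid X) ⊙ N = gpr2 Y X ⊙ F ⊙ K.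

(* The arrow [N x], completed by an identity on the component [Y], has target
   [F (K x)]. *)
Definition path_fun_ob (x : C) : M F :=
  @MOb _ _ F (K x) (GPair (gfst (F (K x))) (M_bot (N x)))
    (GPair (gid _) (gidto (fob_eq e x) ∘ M_arr (N x))).

Lemma path_fun_sq (x y : C) (f : ghom x y) :
  M_arr (path_fun_ob y)
    ∘ (GPair (gfst (gmap F (gmap K f))) (M_hbot (gmap N f))
       : ghom (M_bot (path_fun_ob x)) (M_bot (path_fun_ob y)))
  = gmap F (gmap K f) ∘ M_arr (path_fun_ob x).
Proof.
apply: gpair_eq => /=; first by rewrite gcomp1m gcompm1.
rewrite -gcompA (M_hsq (gmap N f)) !gcompA; congr (_ ∘ _).
exact: (fob_eq_nat e).
Qed.

Definition path_fun : gfunctor C (M F).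
Proof.
refine (@GFunctor C (M F) path_fun_ob (fun x y f => MHom (path_fun_sq f)) _ _).
- by move=> x; apply: M_hom_eq; rewrite /= ?gmap1.
- by move=> x y z g f; apply: M_hom_eq; rewrite /= ?gmapM.
Defined.

Lemma R_path_fun :
  R F ⊙ path_fun = gpairing (gpr1 Y X ⊙ F ⊙ K) (R (gfid X) ⊙ N).
Proof. by gfunctor_refl; rewrite gcomp1m gcompm1. Qed.

End PathFunctor.

Lemma path_fun_eq (Y X A C : groupoid) (F : gfunctor A (gprod Y X))
    (K K' : gfunctor C A) (N N' : gfunctor C (M (gfid X)))
    (e : M_topf (gfid X) ⊙ N = gpr2 Y X ⊙ F ⊙ K)
    (e' : M_topf (gfid X) ⊙ N' = gpr2 Y X ⊙ F ⊙ K') :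
  K = K' -> N = N' -> path_fun e = path_fun e'.
Proof. by move=> eK eN; subst K' N'; rewrite (proof_irrelevance _ e e'). Qed.

Section PathFunctorLemmas.
Variables (Y X A C : groupoid) (F : gfunctor A (gprod Y X)).
Variables (K : gfunctor C A) (N : gfunctor C (M (gfid X))).
Variable e : M_topf (gfid X) ⊙ N = gpr2 Y X ⊙ F ⊙ K.

Lemma path_fun_comp (D : groupoid) (G : gfunctor D C)
    (e' : M_topf (gfid X) ⊙ (N ⊙ G) = gpr2 Y X ⊙ F ⊙ (K ⊙ G)) :
  path_fun e ⊙ G = path_fun e'.
Proof.
M_functor_refl; apply: gpair_eq => /=; rewrite ?gcomp1m ?gcompm1 //.
by congr (gidto _ ∘ _); apply: proof_irrelevance.
Qed.

Lemma path_fun_refl (G : gfunctor C X) : N = L (gfid X) ⊙ G -> path_fun e = L F ⊙ K.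
Proof.
move=> eN; have eG : G = gpr2 Y X ⊙ F ⊙ K.
  by rewrite -e eN; gfunctor_refl.
subst N G; M_functor_refl; apply: gpair_eq => /=; rewrite ?gcompm1 //.
by rewrite gidto_id.
Qed.

Section Nat.
Variables (Y' A' : groupoid) (F' : gfunctor A' (gprod Y' X)) (f : gfunctor Y Y').
Variables (H0 : gfunctor (gprod Y X) (gprod Y' X)) (H1 : gfunctor A A').
Variable sq : H0 ⊙ F = F' ⊙ H1.
Hypothesis H0E : H0 = gpairing (f ⊙ gpr1 Y X) (gpr2 Y X).
Variable e' : M_topf (gfid X) ⊙ N = gpr2 Y' X ⊙ F' ⊙ (H1 ⊙ K).

(** [H0] is the identity on the component [X], so it keeps the arrow of [N], and on the other
    component it sends an identity to an identity. The sources of these arrows agree only through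
    [sq]. *)
Lemma path_fun_nat : M_map sq ⊙ path_fun e = path_fun e'.
Proof.
subst H0.
have ebot x : M_bot ((M_map sq ⊙ path_fun e) x) = M_bot (path_fun e' x).
  by apply: gpair_eq => //=; apply: (f_equal (@gfst _ _) (fob_eq sq (K x))).
apply: (@M_functor_ext _ _ _ _ (M_map sq ⊙ path_fun e) (path_fun e')
  (fun _ => eq_refl) ebot) => [x|x y g|x y g].
- rewrite !gpair_gidto; apply: gpair_eq => /=.
    rewrite !gmap1 !gcomp1m gcompm1 gpair_gidto /=.
    by congr gidto; apply: proof_irrelevance.
  rewrite gmap1 /= gcomp1m gpair_gidto /= gcompA gidto_comp gidto_id gcompm1.
  by congr (gidto _ ∘ _); apply: proof_irrelevance.
- by rewrite /= gcomp1m gcompm1.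
- rewrite !gpair_gidto; apply: gpair_eq => /=; last by rewrite !gidto_id gcomp1m gcompm1.
  have := f_equal (@gfst _ _) (fob_eq_nat sq (gmap K g)).
  rewrite !gpair_gidto /= => h.
  have ee z : f_equal (@gfst _ _) (ebot z) = f_equal (@gfst _ _) (fob_eq sq (K z)).
    exact: proof_irrelevance.
  by rewrite !ee.
Qed.

End Nat.

Section Const.
Variables (Z A' : groupoid) (F' : gfunctor A' Z) (f : gfunctor Y Z).
Variables (H0 : gfunctor (gprod Y X) Z) (H1 : gfunctor A A').
Variable sq : H0 ⊙ F = F' ⊙ H1.
Hypothesis H0E : H0 = f ⊙ gpr1 Y X.

(** [H0] forgets the component in which the path lives and keeps the one with an identity, which
    leaves a unit of the monad. *)
Lemma path_fun_const : M_map sq ⊙ path_fun e = L F' ⊙ (H1 ⊙ K).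
Proof.
subst H0.
apply: (@M_functor_ext _ _ _ _ (M_map sq ⊙ path_fun e) (L F' ⊙ (H1 ⊙ K))
  (fun _ => eq_refl) (fun x => fob_eq sq (K x))) => [x|x y g|x y g] /=.
- by rewrite !gmap1 gcomp1m gcompm1 gcomp1m.
- by rewrite gcomp1m gcompm1.
- exact: (fob_eq_nat sq (gmap K g)).
Qed.

End Const.

End PathFunctorLemmas.

Lemma M_topf_ends (X : groupoid) : M_topf (gfid X) = gpr1 X X ⊙ ends X.
Proof. gfunctor_refl. Qed.

Lemma R_ends (X : groupoid) : R (gfid X) = gpr2 X X ⊙ ends X.
Proof. gfunctor_refl. Qed.

Section Act.
Variables (Y X : groupoid) (a : alg (gprod Y X)).

Local Notation F := (alg_fun a).
Local Notation S := (alg_str a).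

Definition act (C : groupoid) (K : gfunctor C (alg_dom a))
    (N : gfunctor C (M (gfid X)))
    (e : M_topf (gfid X) ⊙ N = gpr2 Y X ⊙ F ⊙ K) : gfunctor C (alg_dom a) :=
  S ⊙ path_fun e.

Section ActLemmas.
Variables (C : groupoid) (K : gfunctor C (alg_dom a)) (N : gfunctor C (M (gfid X))).
Variable e : M_topf (gfid X) ⊙ N = gpr2 Y X ⊙ F ⊙ K.

Lemma act_refl (G : gfunctor C X) : N = L (gfid X) ⊙ G -> act e = K.
Proof. by move=> eN; rewrite /act (path_fun_refl e eN) gfcompA alg_unit gfcomp1m. Qed.

Lemma act_comp (D : groupoid) (G : gfunctor D C)
    (e' : M_topf (gfid X) ⊙ (N ⊙ G) = gpr2 Y X ⊙ F ⊙ (K ⊙ G)) :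
  act e ⊙ G = act e'.
Proof. by rewrite /act -gfcompA (path_fun_comp e e'). Qed.

Lemma act_eq (K' : gfunctor C (alg_dom a)) (N' : gfunctor C (M (gfid X)))
    (e' : M_topf (gfid X) ⊙ N' = gpr2 Y X ⊙ F ⊙ K') :
  K = K' -> N = N' -> act e = act e'.
Proof. by move=> eK eN; rewrite /act (path_fun_eq e e' eK eN). Qed.

Lemma gprod_id : gfid (gprod Y X) = gpairing (gfid Y ⊙ gpr1 Y X) (gpr2 Y X).
Proof. by gfunctor_refl; rewrite gcomp1m gcompm1. Qed.

(** Acting on an element already of the form [S k] is, by the multiplication law, a single
    application of [S] to the composite arrow. *)
Lemma act_str (k : gfunctor C (M F)) (e1 : M_topf (gfid X) ⊙ N = gpr2 Y X ⊙ F ⊙ (S ⊙ k))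
    (e2 : M_topf (gfid X) ⊙ N = gpr2 Y X ⊙ R F ⊙ k) :
  act e1 = S ⊙ (mu F ⊙ path_fun e2).
Proof.
by rewrite gfcompA -alg_mult -gfcompA (path_fun_nat e2 (str_sq (alg_sec a)) gprod_id e1).
Qed.

End ActLemmas.

(** The multiplication law fuses the two transports into one along the composite of an arrow and its
    inverse; the unit law concludes. *)
Lemma act_flipK (C : groupoid) (K : gfunctor C (alg_dom a))
    (N : gfunctor C (M (gfid X))) (e : M_topf (gfid X) ⊙ N = gpr2 Y X ⊙ F ⊙ K)
    (N' : gfunctor C (M (gfid X)))
    (e' : M_topf (gfid X) ⊙ N' = gpr2 Y X ⊙ F ⊙ act e) :
  N = flip X ⊙ N' -> act e' = K.
Proof.
move=> eN; subst N.
have e2 : M_topf (gfid X) ⊙ N' = gpr2 Y X ⊙ R F ⊙ path_fun e by gfunctor_refl.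
rewrite (act_str e' e2).
suff -> : mu F ⊙ path_fun e2 = L F ⊙ K by rewrite gfcompA alg_unit gfcomp1m.
have ebot x : M_bot ((mu F ⊙ path_fun e2) x) = F (K x).
  by apply: gpair_eq => //=; apply: (fob_eq e x).
apply: (@M_functor_ext _ _ _ _ (mu F ⊙ path_fun e2) (L F ⊙ K)
  (fun _ => eq_refl) ebot) => [x|x y g|x y g].
- rewrite gpair_gidto; apply: gpair_eq => /=; rewrite gmap1 /= !gcomp1m.
    by rewrite gidto_id.
  rewrite gidto_id gcomp1m -gcompA gcompVm gcompm1.
  by congr gidto; apply: proof_irrelevance.
- by rewrite /= gcomp1m gcompm1.
- rewrite !gpair_gidto; apply: gpair_eq => /=.
    by rewrite !gidto_id gcomp1m gcompm1.
  have ee z : f_equal (@gsnd _ _) (ebot z) = fob_eq e z by apply: proof_irrelevance.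
  by rewrite !ee; apply: (fob_eq_nat e g).
Qed.

Section ActHom.
Variables (W : groupoid) (c : alg W).
Variables (g1 : gfunctor W (gprod Y X)) (k : gfunctor (alg_dom c) (alg_dom a)).
Variables (sk : g1 ⊙ alg_fun c = F ⊙ k) (tk : k ⊙ alg_str c = S ⊙ M_map sk).
Variables (g2 : gfunctor W (gprod X X)) (N : gfunctor (alg_dom c) (M (gfid X))).
Variables (sN : g2 ⊙ alg_fun c = ends X ⊙ N).
Variables (tN : N ⊙ alg_str c = ends_str X ⊙ M_map sN).
Hypothesis g12 : gpr2 Y X ⊙ g1 = gpr1 X X ⊙ g2.
Variable e : M_topf (gfid X) ⊙ N = gpr2 Y X ⊙ F ⊙ k.

Let g := gpairing (gpr1 Y X ⊙ g1) (gpr2 X X ⊙ g2).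

Lemma path_fun_sq_over : g ⊙ alg_fun c = R F ⊙ path_fun e.
Proof.
rewrite R_path_fun -[gpr1 Y X ⊙ F ⊙ k]gfcompA -sk R_ends -gfcompA -sN.
by gfunctor_refl; rewrite gcomp1m gcompm1.
Qed.

Lemma act_sq : g ⊙ alg_fun c = F ⊙ act e.
Proof. by rewrite path_fun_sq_over gfcompA alg_sec. Qed.

(** The multiplication law writes both sides as [S] after [mu], which leaves an equality of
    composite arrows. *)
Lemma act_hom_str : act e ⊙ alg_str c = S ⊙ M_map act_sq.
Proof.
have e1 : M_topf (gfid X) ⊙ (ends_str X ⊙ M_map sN)
    = gpr2 Y X ⊙ R F ⊙ M_map sk.
  rewrite -[RHS]gfcompA R_nat [RHS]gfcompA g12 M_topf_ends -!gfcompA; congr (_ ⊙ _).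
  by rewrite gfcompA ends_sec R_nat.
have e2 : M_topf (gfid X) ⊙ (ends_str X ⊙ M_map sN)
    = gpr2 Y X ⊙ F ⊙ (S ⊙ M_map sk).
  by rewrite e1 -[RHS]gfcompA (gfcompA F) alg_sec gfcompA.
have e3 : M_topf (gfid X) ⊙ (N ⊙ alg_str c) = gpr2 Y X ⊙ F ⊙ (k ⊙ alg_str c).
  by rewrite gfcompA e gfcompA.
rewrite (act_comp e e3) (act_eq e3 e2 tk tN) (act_str _ e1).
have e4 : gfid _ ⊙ g ⊙ alg_fun c = F ⊙ (S ⊙ path_fun e).
  by rewrite gfcomp1m act_sq.
have -> : M_map act_sq = M_map e4 by apply: M_map_eq => //; rewrite gfcomp1m.
rewrite (M_map_comp path_fun_sq_over (str_sq (alg_sec a)) e4).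
rewrite [RHS]gfcompA alg_mult -[RHS]gfcompA.
congr (_ ⊙ _).
apply: (@M_functor_ext _ _ _ _ (mu F ⊙ path_fun e1) (mu F ⊙ M_map path_fun_sq_over)
  (fun _ => eq_refl) (fun _ => eq_refl)) => [u|u v h|u v h] /=.
- rewrite gmap1 gcomp1m gcompm1.
  rewrite !gpair_gidto; apply: gpair_eq => /=.
    by rewrite gcomp1m gcompm1; congr (gidto _ ∘ _); apply: proof_irrelevance.
  rewrite gcomp1m gcompm1 ginvM gidtoV.
  (* [g1] contributes its component in [X], and [ends_str] the inverse of the first component of
     [g2]; by [g12] they cancel. *)
  have /= nat := fob_eq_nat (eq_sym g12) (M_arr u).
  have -> : fob_eq e1 u = fob_eq (eq_sym g12) (M_bot u) by apply: proof_irrelevance.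
  rewrite !gcompA -[_ ∘ gsnd (gmap g1 _) ∘ gidto _]gcompA -nat.
  rewrite gcompA gcompmK !gidto_comp.
  by congr (_ ∘ _); congr (gidto _ ∘ _ ∘ gidto _); apply: proof_irrelevance.
- by rewrite gcomp1m gcompm1.
- by rewrite !gcomp1m !gcompm1.
Qed.

End ActHom.

End Act.

Section ActNat.
Variables (Y X C : groupoid) (a : alg (gprod Y X)).
Variables (K : gfunctor C (alg_dom a)) (N : gfunctor C (M (gfid X))).
Variable e : M_topf (gfid X) ⊙ N = gpr2 Y X ⊙ alg_fun a ⊙ K.

Lemma act_nat (Y' : groupoid) (a' : alg (gprod Y' X)) (f : gfunctor Y Y')
    (H0 : gfunctor (gprod Y X) (gprod Y' X)) (H1 : gfunctor (alg_dom a) (alg_dom a'))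
    (sq : H0 ⊙ alg_fun a = alg_fun a' ⊙ H1)
    (e' : M_topf (gfid X) ⊙ N = gpr2 Y' X ⊙ alg_fun a' ⊙ (H1 ⊙ K)) :
  H0 = gpairing (f ⊙ gpr1 Y X) (gpr2 Y X) ->
  H1 ⊙ alg_str a = alg_str a' ⊙ M_map sq ->
  H1 ⊙ act e = act e'.
Proof. by move=> H0E str; rewrite gfcompA str -gfcompA (path_fun_nat e sq H0E e'). Qed.

Lemma act_const (Z : groupoid) (a' : alg Z) (f : gfunctor Y Z)
    (H0 : gfunctor (gprod Y X) Z) (H1 : gfunctor (alg_dom a) (alg_dom a'))
    (sq : H0 ⊙ alg_fun a = alg_fun a' ⊙ H1) :
  H0 = f ⊙ gpr1 Y X -> H1 ⊙ alg_str a = alg_str a' ⊙ M_map sq -> H1 ⊙ act e = H1 ⊙ K.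
Proof.
move=> H0E str; rewrite gfcompA str -gfcompA (path_fun_const e sq H0E).
by rewrite gfcompA alg_unit gfcomp1m.
Qed.

End ActNat.

(** The structure of [ends_alg] is composition, and an identity composed with the arrow of [N]
    returns that arrow. *)
Lemma act_of_refl (X C : groupoid) (K N : gfunctor C (M (gfid X)))
    (e : M_topf (gfid X) ⊙ N = gpr2 X X ⊙ alg_fun (ends_alg X) ⊙ K) (G : gfunctor C X) :
  K = L (gfid X) ⊙ G -> act (a := ends_alg X) e = N.
Proof.
move=> eK; subst K.
apply: (@M_functor_ext _ _ _ _ (act (a := ends_alg X) e) N
  (fun x => eq_sym (fob_eq e x)) (fun _ => eq_refl)) => [x|x y g|x y g] /=.
- rewrite ginv_id !gcomp1m gcompm1 gcompA gidto_comp gidto_id.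
  exact: gcomp1m.
- have /= nat := fob_eq_nat e g.
  by rewrite -!gidtoV; symmetry; apply: gsquareV.
- by rewrite gcomp1m gcompm1.
Qed.

(** * Morphisms of algebras between arbitrary objects of the fibres *)

Section FibreHom.
Variables (B B' : groupoid) (f : gfunctor B B').

Local Notation fB := (f : @hom Gpd B B').
Local Notation hom1 g := (rh1 (g : ralg_hom _ _)).

Lemma fib_over_sq (b : fib B) (b' : fib B') (g : hom (fibre_val b) (fibre_val b')) :
  is_over fB g -> f ⊙ alg_fun (alg_of b) = alg_fun (alg_of b') ⊙ hom1 g.
Proof.
move: b g; apply: fib_rect => b; move: b'; apply: fib_rect => b' g.
exact: (@alg_over_sq _ _ f b b' g).
Qed.

Lemma fib_over_str (b : fib B) (b' : fib B') (g : hom (fibre_val b) (fibre_val b'))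
    (e : f ⊙ alg_fun (alg_of b) = alg_fun (alg_of b') ⊙ hom1 g) :
  is_over fB g -> hom1 g ⊙ alg_str (alg_of b) = alg_str (alg_of b') ⊙ M_map e.
Proof.
move: b g e; apply: fib_rect => b; move: b'; apply: fib_rect => b' g e o.
rewrite [LHS](rh_str (g : ralg_hom _ _)); congr (_ ⊙ _); apply: M_map_eq => //.
exact: alg_over o.
Qed.

Lemma fib_over_eq (b : fib B) (b' : fib B') (g g' : hom (fibre_val b) (fibre_val b')) :
  is_over fB g -> is_over fB g' -> hom1 g = hom1 g' -> g = g'.
Proof.
move: b g g'; apply: fib_rect => b; move: b'; apply: fib_rect => b' g g'.
exact: (@alg_over_eq _ _ f b b' g g').
Qed.

Lemma fib_over_build (b : fib B) (b' : fib B')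
    (h : gfunctor (alg_dom (alg_of b)) (alg_dom (alg_of b')))
    (e : f ⊙ alg_fun (alg_of b) = alg_fun (alg_of b') ⊙ h) :
  h ⊙ alg_str (alg_of b) = alg_str (alg_of b') ⊙ M_map e ->
  { g : hom_over fB b b' | hom1 (over_val g) = h }.
Proof.
move: b h e; apply: fib_rect => b; move: b'; apply: fib_rect => b' h e s.
by exists (@alg_hom _ _ f b b' h e s).
Qed.

End FibreHom.

(** * The transport structure *)

Local Notation Id X := (canon (ends_alg X) : fib (cprod gpd_products X X)).
Local Notation paths A := (path_lift (P := gpd_products) ralg_joint_lifts (fun X => Id X) A).
Local Notation hom1 g := (rh1 (over_val g : ralg_hom _ _)).

(** The construction is opaque, so its formula is kept as an equation; by [act_eq] the choice of [e]
    is immaterial. *)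
Lemma act_exists (W Y X : groupoid) (c : fib W) (A : fib (gprod Y X))
    (g1 : @hom Gpd W (gprod Y X)) (k : hom_over g1 c A)
    (g2 : @hom Gpd W (gprod X X)) (n : hom_over g2 c (Id X)) :
  gpr2 Y X ⊙ g1 = gpr1 X X ⊙ g2 ->
  { t : hom_over (gpairing (gpr1 Y X ⊙ g1) (gpr2 X X ⊙ g2) : @hom Gpd W (gprod Y X)) c A |
    exists e, hom1 t = @act Y X (alg_of A) _ (hom1 k) (hom1 n) e }.
Proof.
move=> g12.
have sk := fib_over_sq (over_valP k); have tk := fib_over_str sk (over_valP k).
have sn := fib_over_sq (over_valP n); have tn := fib_over_str sn (over_valP n).
have e : M_topf (gfid X) ⊙ hom1 n = gpr2 Y X ⊙ alg_fun (alg_of A) ⊙ hom1 k.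
  by rewrite M_topf_ends -[LHS]gfcompA -[ends X ⊙ _]sn gfcompA -g12 -gfcompA sk gfcompA.
have [t tE] := fib_over_build (@act_hom_str Y X (alg_of A) W (alg_of c) _ _ sk tk _ _ sn tn g12 e).
by exists t; exists e.
Qed.

Lemma tr_exists (Y X : groupoid) (A : fib (gprod Y X)) :
  { t : hom_over (pr13 gpd_products Y X) (sl_ob (paths A)) A |
    exists e, hom1 t = @act Y X (alg_of A) _
      (hom1 (sl_p1 (paths A)))
      (hom1 (sl_p2 (paths A))) e }.
Proof.
have g12 : gpr2 Y X ⊙ pr1 gpd_products (gprod Y X) X
    = gpr1 X X ⊙ pr23 gpd_products Y X by rewrite gpr1_pairing.
have [t tE] := act_exists (sl_p1 (paths A))
  (sl_p2 (paths A)) g12.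
have e : gpairing (gpr1 Y X ⊙ pr1 gpd_products (gprod Y X) X)
    (gpr2 X X ⊙ pr23 gpd_products Y X) = pr13 gpd_products Y X by rewrite gpr2_pairing.
by exists (recast t e).
Qed.

Lemma refl_exists (X : groupoid) (c : fib X) :
  { h : hom_over (diagonal gpd_products X) c (Id X) |
    exists G, hom1 h = L (gfid X) ⊙ G }.
Proof.
have [h hE] := fib_over_build (b := c) (b' := Id X) (refl_str (alg_of c)).
by exists h; exists (alg_fun (alg_of c)).
Qed.

Definition ralg_tr (Y X : groupoid) (A : fib (gprod Y X)) := proj1_sig (tr_exists A).

Definition ralg_refl (X : groupoid) :=
  proj1_sig (refl_exists (fibre_top ralg_joint_lifts X)).

(** Transport of a generalised element is the action on its two components, which reduces each law
    about [tr] to a lemma on [act]. *)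
Lemma ralg_trE (Y X W : groupoid) (A : fib (gprod Y X)) (c : fib W)
    (s : hom (fibre_val c) (fibre_val (sl_ob (paths A)))) :
  exists e, hom1 (ralg_tr A) ⊙ rh1 (s : ralg_hom _ _) =
    @act Y X (alg_of A) _
      (rh1 ((over_val (sl_p1 (paths A)) ∘ s)%cat : ralg_hom _ _))
      (rh1 ((over_val (sl_p2 (paths A)) ∘ s)%cat : ralg_hom _ _)) e.
Proof.
have [e ->] := proj2_sig (tr_exists A).
have e' : M_topf (gfid X)
      ⊙ rh1 ((over_val (sl_p2 (paths A)) ∘ s)%cat : ralg_hom _ _)
    = gpr2 Y X ⊙ alg_fun (alg_of A)
      ⊙ rh1 ((over_val (sl_p1 (paths A)) ∘ s)%cat : ralg_hom _ _).
  exact: (eq_trans (gfcompA _ _ _) (eq_trans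
    (f_equal (fun G => G ⊙ rh1 (s : ralg_hom _ _)) e) (eq_sym (gfcompA _ _ _)))).
by exists e'; exact: (@act_comp Y X (alg_of A) _ _ _ e _ (rh1 (s : ralg_hom _ _)) e').
Qed.

Definition ralg_sym (X : groupoid) : hom_over (swap gpd_products X) (Id X) (Id X) :=
  alg_hom (a := ends_alg X) (b := ends_alg X) (flip_str X).

Lemma refl_L (X W : groupoid) (c : fib W)
    (z : hom (fibre_val c) (fibre_val (fibre_top ralg_joint_lifts X)))
    (n : hom (fibre_val c) (fibre_val (Id X))) :
  n = (over_val (ralg_refl X) ∘ z)%cat ->
  exists G, rh1 (n : ralg_hom _ _) = L (gfid X) ⊙ G.
Proof.
move=> ->; have [G eG] := proj2_sig (refl_exists (fibre_top ralg_joint_lifts X)).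
exists (G ⊙ rh1 (z : ralg_hom _ _)); rewrite gfcompA -eG; exact: eq_refl.
Qed.

Lemma ralg_tr_on_refl (Y X : groupoid) (A : fib (gprod Y X)) (W : groupoid)
    (c : fib W) (u : @hom Gpd W (gprod (gprod Y X) X)) (v : @hom Gpd W X)
    (s : hom_over u c (sl_ob (paths A)))
    (z : hom_over v c (fibre_top ralg_joint_lifts X)) :
  (over_val (sl_p2 (paths A)) ∘ over_val s
    = over_val (ralg_refl X) ∘ over_val z ->
  over_val (ralg_tr A) ∘ over_val s = over_val (sl_p1 (paths A)) ∘ over_val s)%cat.
Proof.
(* By [e] one arrow lies over two base arrows, which gives an equation on [u] and puts both sides of
   the goal over the same base arrow. *)
move=> e; have oz := is_over_comp (ralg_refl X) z; rewrite -e in oz.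
have eb := pr13_diagonal (is_over_base (is_over_comp (sl_p2 (paths A)) s) oz).
have o := is_over_comp (ralg_tr A) s; rewrite eb in o.
apply: (fib_over_eq o (is_over_comp (sl_p1 (paths A)) s)).
have [e' tE] := ralg_trE (over_val s); have [G eG] := refl_L e.
exact: (eq_trans tE (@act_refl Y X (alg_of A) _ _ _ e' G eG)).
Qed.

Lemma ralg_tr_nat (Y Y' X : groupoid) (f : @hom Gpd Y Y') (A : fib (gprod Y X))
    (A' : fib (gprod Y' X))
    (w : hom_over (prod_map gpd_products f (idm (X : Gpd))) A A') (W : groupoid) (c : fib W)
    (u : @hom Gpd W (gprod (gprod Y X) X)) (u' : @hom Gpd W (gprod (gprod Y' X) X))
    (s : hom_over u c (sl_ob (paths A))) (s' : hom_over u' c (sl_ob (paths A'))) :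
  (over_val (sl_p1 (paths A')) ∘ over_val s'
    = over_val w ∘ (over_val (sl_p1 (paths A)) ∘ over_val s) ->
  over_val (sl_p2 (paths A')) ∘ over_val s' = over_val (sl_p2 (paths A)) ∘ over_val s ->
  over_val w ∘ (over_val (ralg_tr A) ∘ over_val s) = over_val (ralg_tr A') ∘ over_val s')%cat.
Proof.
move=> e1 e2.
have o1 : is_over (prod_map gpd_products f (idm (X : Gpd)) ∘ (pr1 gpd_products _ X ∘ u))%cat
    (over_val (sl_p1 (paths A')) ∘ over_val s')%cat.
  by rewrite e1; apply: (is_over_comp w (over_comp (sl_p1 (paths A)) s)).
have o2 := is_over_comp (sl_p2 (paths A)) s; rewrite -e2 in o2.
have eb := pr13_nat (is_over_base (is_over_comp (sl_p1 (paths A')) s') o1)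
  (is_over_base (is_over_comp (sl_p2 (paths A')) s') o2).
have o := is_over_comp w (over_comp (ralg_tr A) s); rewrite eb in o.
apply: (fib_over_eq o (is_over_comp (ralg_tr A') s')).
have [e tE] := ralg_trE (over_val s); have [e' tE'] := ralg_trE (over_val s').
have sq := fib_over_sq (over_valP w); have str := fib_over_str sq (over_valP w).
pose K := rh1 ((over_val (sl_p1 (paths A)) ∘ over_val s)%cat : ralg_hom _ _).
have eK : rh1 ((over_val (sl_p1 (paths A')) ∘ over_val s')%cat : ralg_hom _ _)
    = hom1 w ⊙ K by rewrite e1.
have eN : rh1 ((over_val (sl_p2 (paths A')) ∘ over_val s')%cat : ralg_hom _ _)
    = rh1 ((over_val (sl_p2 (paths A)) ∘ over_val s)%cat : ralg_hom _ _) by rewrite e2.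
have e'' := e'; rewrite eK eN in e''.
have H0E : prod_map gpd_products f (idm (X : Gpd)) = gpairing (f ⊙ gpr1 Y X) (gpr2 Y X).
  by rewrite /prod_map comp1m.
refine (eq_trans (f_equal (fun G => hom1 w ⊙ G) tE) (eq_trans
  (@act_nat Y X _ (alg_of A) _ _ e Y' (alg_of A') f _ _ sq e'' H0E str)
  (eq_trans _ (eq_sym tE')))).
exact: (@act_eq Y' X (alg_of A') _ _ _ e'' _ _ e' (eq_sym eK) (eq_sym eN)).
Qed.

Lemma ralg_tr_of_refl (X W : groupoid) (c : fib W)
    (u : @hom Gpd W (gprod (gprod X X) X)) (v : @hom Gpd W X)
    (s : hom_over u c (sl_ob (paths (Id X))))
    (z : hom_over v c (fibre_top ralg_joint_lifts X)) :
  (over_val (sl_p1 (paths (Id X))) ∘ over_val s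
    = over_val (ralg_refl X) ∘ over_val z ->
  over_val (ralg_tr (Id X)) ∘ over_val s = over_val (sl_p2 (paths (Id X))) ∘ over_val s)%cat.
Proof.
move=> e; have oz := is_over_comp (ralg_refl X) z; rewrite -e in oz.
have eb := pr13_diagonal_id (is_over_base (is_over_comp (sl_p1 (paths (Id X))) s) oz).
have o := is_over_comp (ralg_tr (Id X)) s; rewrite eb in o.
apply: (fib_over_eq o (is_over_comp (sl_p2 (paths (Id X))) s)).
have [e' tE] := ralg_trE (over_val s); have [G eG] := refl_L e.
exact: (eq_trans tE (@act_of_refl X _ _ _ e' G eG)).
Qed.

Lemma ralg_tr_const (Y Z X : groupoid) (g : @hom Gpd Y Z) (A : fib (gprod Y X))
    (C : fib Z) (w : hom_over (g ∘ pr1 gpd_products Y X)%cat A C) (W : groupoid)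
    (c : fib W) (u : @hom Gpd W (gprod (gprod Y X) X)) (s : hom_over u c (sl_ob (paths A))) :
  (over_val w ∘ (over_val (ralg_tr A) ∘ over_val s)
    = over_val w ∘ (over_val (sl_p1 (paths A)) ∘ over_val s))%cat.
Proof.
have o := is_over_comp w (over_comp (ralg_tr A) s).
have o' := is_over_comp w (over_comp (sl_p1 (paths A)) s).
have eb : (g ∘ pr1 gpd_products Y X ∘ (pr13 gpd_products Y X ∘ u)
    = g ∘ pr1 gpd_products Y X ∘ (pr1 gpd_products _ X ∘ u))%cat.
  by rewrite /pr13 -!compA (compA (pr1 gpd_products Y X)) pr1_cpair -!compA.
rewrite eb in o; apply: (fib_over_eq o o').
have [e tE] := ralg_trE (over_val s).
have sq := fib_over_sq (over_valP w); have str := fib_over_str sq (over_valP w).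
exact: (eq_trans (f_equal (fun G => hom1 w ⊙ G) tE)
  (@act_const Y X _ (alg_of A) _ _ e Z (alg_of C) g _ _ sq eq_refl str)).
Qed.

Lemma ralg_tr_symK (Y X : groupoid) (A : fib (gprod Y X)) (W : groupoid)
    (c : fib W) (u u' : @hom Gpd W (gprod (gprod Y X) X))
    (s : hom_over u c (sl_ob (paths A))) (s' : hom_over u' c (sl_ob (paths A))) :
  (over_val (sl_p1 (paths A)) ∘ over_val s' = over_val (ralg_tr A) ∘ over_val s ->
  over_val (sl_p2 (paths A)) ∘ over_val s
    = over_val (ralg_sym X) ∘ (over_val (sl_p2 (paths A)) ∘ over_val s') ->
  over_val (ralg_tr A) ∘ over_val s' = over_val (sl_p1 (paths A)) ∘ over_val s)%cat.
Proof.
move=> e1 e2.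
have o1 := is_over_comp (ralg_tr A) s; rewrite -e1 in o1.
have o2 : is_over (swap gpd_products X ∘ (pr23 gpd_products Y X ∘ u'))%cat
    (over_val (sl_p2 (paths A)) ∘ over_val s)%cat.
  by rewrite e2; apply: (is_over_comp (ralg_sym X) (over_comp (sl_p2 (paths A)) s')).
have eb := pr13_swap (is_over_base (is_over_comp (sl_p1 (paths A)) s') o1)
  (is_over_base (is_over_comp (sl_p2 (paths A)) s) o2).
have o := is_over_comp (ralg_tr A) s'; rewrite eb in o.
apply: (fib_over_eq o (is_over_comp (sl_p1 (paths A)) s)).
have [e tE] := ralg_trE (over_val s); have [e' tE'] := ralg_trE (over_val s').
have eK : rh1 ((over_val (sl_p1 (paths A)) ∘ over_val s')%cat : ralg_hom _ _)
    = @act Y X (alg_of A) _ _ _ e by rewrite e1; exact: tE.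
have eN : rh1 ((over_val (sl_p2 (paths A)) ∘ over_val s)%cat : ralg_hom _ _)
    = flip X ⊙ rh1 ((over_val (sl_p2 (paths A)) ∘ over_val s')%cat : ralg_hom _ _).
  by rewrite e2.
have e'' := e'; rewrite eK in e''.
refine (eq_trans tE' (eq_trans (@act_eq Y X (alg_of A) _ _ _ e' _ _ e'' eK eq_refl) _)).
exact: (@act_flipK Y X (alg_of A) _ _ _ e _ e'' eN).
Qed.

(** The inverse of an identity is an identity, which is [flip_L]. *)
Lemma ralg_sym_refl (X : groupoid) :
  (over_val (ralg_sym X) ∘ over_val (ralg_refl X) = over_val (ralg_refl X))%cat.
Proof.
have o := is_over_comp (ralg_sym X) (ralg_refl X).
have eb : (swap gpd_products X ∘ diagonal gpd_products X = diagonal gpd_products X)%cat.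
  by prod_eq.
rewrite eb in o; apply: (fib_over_eq o (over_valP _)).
have [G eG] := proj2_sig (refl_exists (fibre_top ralg_joint_lifts X)).
rewrite [RHS]eG -[in RHS]flip_L -gfcompA -eG; exact: eq_refl.
Qed.

Definition ralg_transport : transport_structure ralg_joint_lifts gpd_products :=
  @TransportStructure RAlg Gpd RAlg_base ralg_joint_lifts gpd_products
    (fun X => Id X) ralg_refl ralg_sym ralg_tr ralg_sym_refl ralg_tr_on_refl
    ralg_tr_of_refl ralg_tr_nat ralg_tr_const ralg_tr_symK.

Theorem corollary5p5 : elementary_fibration RAlg_base.
Proof. exact: transport_elementary ralg_transport. Qed.
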